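(* Let $\nu>0$ be real with $\nu\notin\mathbb{Z}$, and let $z\in\mathbb{C}$, $z\neq 0$, $|\arg z|<\pi$. Then $$\begin{aligned}\frac{\partial Y_\nu(z)}{\partial\nu}={}&J_\nu(z)\left[\frac{\Gamma^2(\nu)}{2\pi}\left(\frac z2\right)^{-2\nu}{}_2F_3\left(\left.\begin{array}{c}-\nu,\ \frac12-\nu\\ 1-\nu,\ 1-\nu,\ 1-2\nu\end{array}\right|-z^2\right)-\pi\csc^2(\pi\nu)\right]\\&-\frac{\cos(\pi\nu)}{2\pi}\Gamma^2(-\nu)J_{-\nu}(z)\left(\frac z2\right)^{2\nu}{}_2F_3\left(\left.\begin{array}{c}\nu,\ \nu+\frac12\\ \nu+1,\ \nu+1,\ 2\nu+1\end{array}\right|-z^2\right)\\&+\left[\log\left(\frac2z\right)+\frac1{2\nu}+\psi(\nu)+\frac{z^2}{4(1-\nu^2)}\,{}_3F_4\left(\left.\begin{array}{c}1,\ 1,\ \frac32\\ 2,\ 2,\ 2-\nu,\ 2+\nu\end{array}\right|-z^2\right)\right]\bigl(Y_\nu(z)-2\cot(\pi\nu)\,J_\nu(z)\bigr).\end{aligned}$$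
   Context: Powers and logarithms take their principal values. $J_\nu(z)=(z/2)^\nu\sum_{k\ge0}\frac{(-1)^k(z/2)^{2k}}{k!\,\Gamma(\nu+k+1)}$ and, for $\nu\notin\mathbb{Z}$, $Y_\nu(z)=\frac{J_\nu(z)\cos\pi\nu-J_{-\nu}(z)}{\sin\pi\nu}$ are the Bessel functions of the first and second kind; $\partial/\partial\nu$ is the derivative with respect to the order at fixed $z$. $\Gamma$ is the gamma function and $\psi=\Gamma'/\Gamma$ is the digamma function. The generalized hypergeometric function is ${}_pF_q\left(\left.\begin{array}{c}a_1,\dots,a_p\\ b_1,\dots,b_q\end{array}\right|x\right)=\sum_{k\ge0}\frac{(a_1)_k\cdots(a_p)_k}{(b_1)_k\cdots(b_q)_k}\frac{x^k}{k!}$ with $(\alpha)_k=\Gamma(\alpha+k)/\Gamma(\alpha)$.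
   Formalization: When ν is a half-integer, the first 2F3 (with parameters 1/2−ν above and 1−2ν below) is undefined as a series because of 0/0 terms; there it is read as its limit as the order tends to ν. For all other ν the formula is taken literally. *)

(* Defs.v *)
(* Stdlib reals and Coquelicot; complex numbers are Coquelicot's [C]. *)
From Stdlib Require Export Reals Factorial List ClassicalEpsilon.
From Coquelicot Require Export Coquelicot.
Export ListNotations.
Open Scope R_scope.

(** * Elementary complex functions, principal values *)

Definition Cexp (w : C) : C :=
  (exp (Re w) * cos (Im w), exp (Re w) * sin (Im w)).

(* The argument in (-PI, PI] (meaningful for z <> 0). *)
Definition Carg (z : C) : R :=
  if Rle_dec 0 (Im z) then acos (Re z / Cmod z) else - acos (Re z / Cmod z).

Definition Clog (z : C) : C := (ln (Cmod z), Carg z).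

Definition Cpower (z a : C) : C := Cexp (a * Clog z)%C.

Definition CSeries (a : nat -> C) : C :=
  (Series (fun k => Re (a k)), Series (fun k => Im (a k))).

(** * Gamma and digamma functions of a real argument *)

(* Product x (x + 1) ... (x + n). *)
Fixpoint gauss_prod (x : R) (n : nat) : R :=
  match n with
  | O => x
  | S m => gauss_prod x m * (x + INR n)
  end.

(* Gauss' definition
     Gamma x = lim_n  n! n^x / (x (x + 1) ... (x + n)),
   valid for every real x which is not a pole.  At the poles 0, -1, -2, ...
   the convention / 0 = 0 gives Gamma x = 0, and hence / Gamma x = 0,
   the usual value of the reciprocal gamma function there. *)
Definition Gamma (x : R) : R :=
  real (Lim_seq (fun n => INR (fact n) * Rpower (INR n) x / gauss_prod x n)).

Definition digamma (x : R) : R := Derive Gamma x / Gamma x.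

(** * Bessel functions of real order *)

Definition BesselJ (nu : R) (z : C) : C :=
  (Cpower (z / 2) nu *
   CSeries (fun k =>
     RtoC (-1) ^ k * (z / 2) ^ (2 * k)
     / RtoC (INR (fact k) * Gamma (nu + INR k + 1))))%C.

(* Only meaningful for a non-integer order. *)
Definition BesselY (nu : R) (z : C) : C :=
  ((BesselJ nu z * RtoC (cos (PI * nu)) - BesselJ (- nu) z)
   / RtoC (sin (PI * nu)))%C.

(** * Generalized hypergeometric functions with real parameters *)

(* Only meaningful when a is not a pole of Gamma. *)
Definition poch (a : R) (k : nat) : R := Gamma (a + INR k) / Gamma a.

Definition poch_list (l : list R) (k : nat) : R :=
  fold_right (fun a p => poch a k * p) 1 l.

Definition pFq (a b : list R) (x : C) : C :=
  CSeries (fun k =>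
    RtoC (poch_list a k / poch_list b k) * x ^ k / RtoC (INR (fact k)))%C.

Definition RClim (f : R -> C) (t : R) : C :=
  (real (Lim (fun s => Re (f s)) t), real (Lim (fun s => Im (f s)) t)).

Definition nonpos_int (c : R) : Prop := exists n : nat, c = - INR n.

(* The value at t of pFq (a s) (b s) x, for parameters depending on a real s.
   When some lower parameter b_j(t) is a nonpositive integer the series itself
   is not defined, and the value is taken by continuity in s.  For upper
   parameters -s, 1/2 - s and lower parameters 1 - s, 1 - s, 1 - 2 s this occurs
   at half-integers t > 0, where (1/2 - t)_k / (1 - 2 t)_k has the form 0/0 for
   k >= 2 t but the limit as s -> t is finite and nonzero; dropping these terms
   would give a different function. *)
Definition pFq_cont (a b : R -> list R) (x : C) (t : R) : C :=
  if excluded_middle_informative (Exists nonpos_int (b t))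
  then RClim (fun s => pFq (a s) (b s) x) t
  else pFq (a t) (b t) x.

(* Main.v *)
Require Import Defs.
From Stdlib Require Import ZArith Lra Lia FunctionalExtensionality.

(* Write J_nu(z) = (z/2)^nu / Gamma(nu+1) f_nu(x) with x = (z/2)^2 and
   f_nu = sum (-x)^n / (n! (nu+1)_n), so that theta (theta + nu) f_nu = - x f_nu for theta = x d/dx.
   If A and G are the power series with (theta + nu) A = nu f_nu^2, A(0) = 1, and
   theta G = (1 - f_nu f_{-nu}) / 2, G(0) = 0, then
     d f_nu / d nu = f_nu (1/(2 nu) - G) - (1/(2 nu)) f_{-nu} A :
   both sides have constant term 0 and solve theta (theta + nu) g + theta f_nu = - x g, by the
   Wronskian identity f_{-nu} theta f_nu - f_nu theta f_{-nu} + nu f_nu f_{-nu} = nu, and that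
   equation determines the coefficients recursively.  The third-order equations satisfied by
   f_nu^2 and f_nu f_{-nu} identify A with the 2F3 and G with x/(1-nu^2) times the 3F4.  The
   reflection formula for Gamma, used once for the constants and once differentiated, turns this
   into the derivative of J at nu and at -nu, hence of Y.  At half-integers the 2F3 with
   parameter -nu is a limit, which dominated convergence computes coefficientwise. *)

(** * Dominated series *)

(** The formula for d f_nu / d nu is variation of constants. Both f_nu and x^(-nu) f_{-nu} solve
    theta (theta + nu) g = - x g, and differentiating this in nu adds the source - theta f_nu. By
    the Wronskian, the coefficient of x^(-nu) f_{-nu} is an integral of x^nu theta (f_nu^2) / (2
    nu); integration by parts leaves the integral of nu x^nu f_nu^2, which is x^nu A. In the same
    way G comes from the coefficient of f_nu. In terms of A and G the powers x^nu drop out, so the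
    core is an identity between formal power series with real coefficients, checked by [ring]; z
    enters only when the series are summed. The other obstacle is that Gamma is given only as Gauss'
    limit. Convergence and differentiability come from a telescoped logarithm for x > 0 and are
    carried to the left by Gamma (x + 1) = x Gamma x; the reflection formula comes from integrals of
    Wallis type. *)

Lemma ex_series_Rle (a B : nat -> R) :
  (forall n, Rabs (a n) <= B n) -> ex_series B -> ex_series a.
Proof. exact (@ex_series_le R_AbsRing R_CompleteNormedModule a B). Qed.

Lemma ex_series_Rscal (c : R) (a : nat -> R) :
  ex_series a -> ex_series (fun n => c * a n).
Proof. exact (@ex_series_scal R_AbsRing R_NormedModule c a). Qed.

Lemma Rabs_Series_le (a B : nat -> R) :
  (forall n, Rabs (a n) <= B n) -> ex_series B -> Rabs (Series a) <= Series B.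
Proof.
  intros H HB. eapply Rle_trans.
  - apply Series_Rabs. apply (ex_series_Rle _ B); [|exact HB].
    intros n. rewrite Rabs_Rabsolu. apply H.
  - apply Series_le; [|exact HB]. intros n. split; [apply Rabs_pos|apply H].
Qed.

Lemma filterlim_sum_f_R0 {T : Type} (F : (T -> Prop) -> Prop) {FF : Filter F}
  (u : T -> nat -> R) (l : nat -> R) (N : nat) :
  (forall n, (n <= N)%nat -> filterlim (fun s => u s n) F (locally (l n))) ->
  filterlim (fun s => sum_f_R0 (u s) N) F (locally (sum_f_R0 l N)).
Proof.
  induction N as [|N IH]; intros H; simpl.
  - apply H. lia.
  - apply (filterlim_comp_2 (G := locally (sum_f_R0 l N)) (H := locally (l (S N)))).
    + apply IH. intros n Hn. apply H. lia.
    + apply H. lia.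
    + apply (filterlim_plus (K := R_AbsRing) (V := R_NormedModule)).
Qed.

(** Tannery's theorem. It is applied to punctured neighbourhoods twice: to difference quotients, for
    termwise differentiation, and to the 2F3 at half-integers. *)
Lemma filterlim_Series_dominated {T : Type} (F : (T -> Prop) -> Prop) {FF : Filter F}
  (u : T -> nat -> R) (l B : nat -> R) :
  (forall n, filterlim (fun s => u s n) F (locally (l n))) ->
  F (fun s => forall n, Rabs (u s n) <= B n) ->
  (forall n, Rabs (l n) <= B n) -> ex_series B ->
  filterlim (fun s => Series (u s)) F (locally (Series l)).
Proof.
  intros Hu HF Hl HB. apply (filterlim_locally (U := R_UniformSpace)). intros eps.
  (* One [eps / 4] is spent on the partial sums and one on each of the two tails, which leaves a
     strict inequality. *)
  assert (He : 0 < eps / 4) by (destruct eps; simpl; lra).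
  assert (exists N, Rabs (Series (fun k => B (S N + k)%nat)) < eps / 4) as [N HN].
  { generalize (Series_correct B HB). intros HS.
    apply (proj2 (is_lim_seq_spec (sum_n B) (Series B))) in HS.
    destruct (HS (mkposreal _ He)) as [N HN]. exists N. simpl in HN.
    specialize (HN N (le_n N)). rewrite sum_n_Reals in HN.
    rewrite (Series_incr_n B (S N)) in HN; [|lia|exact HB]. simpl pred in HN.
    revert HN. unfold Rabs. destruct (Rcase_abs _), (Rcase_abs _); lra. }
  generalize (filterlim_sum_f_R0 F u l N (fun n _ => Hu n)). intros Hs.
  apply (proj1 (filterlim_locally (U := R_UniformSpace) _ _)) with (eps := mkposreal _ He) in Hs.
  generalize (filter_and _ _ Hs HF). apply filter_imp. intros s [H1 H2].
  change (Rabs (sum_f_R0 (u s) N - sum_f_R0 l N) < eps / 4) in H1.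
  change (Rabs (Series (u s) - Series l) < eps).
  assert (HBt : ex_series (fun k => B (S N + k)%nat)) by now apply ex_series_incr_n.
  rewrite (Series_incr_n (u s) (S N)), (Series_incr_n l (S N));
    try lia; try (now apply (ex_series_Rle _ B)).
  simpl pred.
  generalize (Rabs_Series_le (fun k => u s (S N + k)%nat) _ (fun n => H2 (S N + n)%nat) HBt).
  generalize (Rabs_Series_le (fun k => l (S N + k)%nat) _ (fun n => Hl (S N + n)%nat) HBt).
  generalize (Rle_abs (Series (fun k => B (S N + k)%nat))).
  revert HN H1.
  set (x := Series (fun k => u s _)). set (y := Series (fun k => l _)).
  intros. replace (_ - _) with ((sum_f_R0 (u s) N - sum_f_R0 l N) + (x + - y)) by ring.
  eapply Rle_lt_trans; [apply Rabs_triang|].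
  generalize (Rabs_triang x (- y)). rewrite Rabs_Ropp. lra.
Qed.

Lemma Rabs_increment_le (f df : R -> R) (t s d M : R) :
  (forall x, Rabs (x - t) < d -> is_derive f x (df x)) ->
  (forall x, Rabs (x - t) < d -> Rabs (df x) <= M) ->
  Rabs (s - t) < d -> Rabs (f s - f t) <= M * Rabs (s - t).
Proof.
  intros Hd Hb Hs.
  assert (Hin : forall x, Rmin t s <= x <= Rmax t s -> Rabs (x - t) < d).
  { intros x. unfold Rmin, Rmax. revert Hs. unfold Rabs.
    destruct (Rle_dec t s); destruct (Rcase_abs _), (Rcase_abs _); lra. }
  destruct (MVT_gen f t s df) as [c [Hc ->]].
  - intros x Hx. apply Hd, Hin. lra.
  - intros x Hx. apply derivable_continuous_pt. exists (df x).
    apply is_derive_Reals, Hd, Hin, Hx.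
  - rewrite Rabs_mult. apply Rmult_le_compat_r; [apply Rabs_pos|]. apply Hb, Hin, Hc.
Qed.

(** By the mean value theorem the bound [B n] on the derivatives also bounds the difference
    quotients, and dominated convergence applies to these. *)
Lemma is_derive_Series (u du : R -> nat -> R) (t d : R) (B : nat -> R) :
  0 < d ->
  (forall n s, Rabs (s - t) < d -> is_derive (fun s => u s n) s (du s n)) ->
  (forall n s, Rabs (s - t) < d -> Rabs (du s n) <= B n) ->
  ex_series B -> ex_series (u t) ->
  is_derive (fun s => Series (u s)) t (Series (du t)).
Proof.
  intros Hd Hu Hb HB Ht.
  assert (Hinc : forall n s, Rabs (s - t) < d -> Rabs (u s n - u t n) <= B n * Rabs (s - t)).
  { intros n s Hs. apply (Rabs_increment_le (fun s => u s n) (fun s => du s n) t s d); auto. }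
  assert (Hex : forall s, Rabs (s - t) < d -> ex_series (fun n => u s n - u t n)).
  { intros s Hs. apply (ex_series_Rle _ (fun n => B n * Rabs (s - t))).
    - intros n. now apply Hinc.
    - now apply ex_series_scal_r. }
  assert (Hq : filterlim (fun h => Series (fun n => (u (t + h) n - u t n) / h))
                 (Rbar_locally' 0) (locally (Series (du t)))).
  { apply (filterlim_Series_dominated _ _ _ B); auto.
    - intros n.
      assert (H0 : Rabs (t - t) < d) by (rewrite Rminus_diag, Rabs_R0; exact Hd).
      specialize (Hu n t H0). apply is_derive_Reals in Hu.
      apply (filterlim_locally (U := R_UniformSpace)). intros eps.
      destruct (Hu eps (cond_pos eps)) as [e He]. exists e. intros h Hh Hh0.
      apply He; [exact Hh0|]. change (Rabs (h - 0) < e) in Hh. now rewrite Rminus_0_r in Hh.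
    - exists (mkposreal d Hd). intros h Hh Hh0 n.
      change (Rabs (h - 0) < d) in Hh. rewrite Rminus_0_r in Hh.
      unfold Rdiv. rewrite Rabs_mult, Rabs_inv.
      apply Rmult_le_reg_r with (Rabs h); [now apply Rabs_pos_lt|].
      rewrite Rmult_assoc, Rinv_l, Rmult_1_r by now apply Rabs_no_R0.
      specialize (Hinc n (t + h)). rewrite Rplus_minus_l in Hinc.
      now apply Hinc.
    - intros n. apply Hb. rewrite Rminus_diag, Rabs_R0; exact Hd. }
  apply is_derive_Reals. intros eps Heps.
  apply (proj1 (filterlim_locally (U := R_UniformSpace) _ _)) with (eps := mkposreal _ Heps) in Hq.
  destruct Hq as [e He].
  assert (Hm : 0 < Rmin e d) by (apply Rmin_pos; [apply cond_pos|exact Hd]).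
  exists (mkposreal _ Hm). simpl. intros h Hh0 Hh.
  assert (H1 : Rabs h < e) by (eapply Rlt_le_trans; [exact Hh|apply Rmin_l]).
  assert (H2 : Rabs h < d) by (eapply Rlt_le_trans; [exact Hh|apply Rmin_r]).
  assert (H3 : Rabs (h - 0) < e) by now rewrite Rminus_0_r.
  specialize (He h H3 Hh0).
  change (Rabs (Series (fun n => (u (t + h) n - u t n) / h) - Series (du t)) < eps) in He.
  replace ((Series (u (t + h)) - Series (u t)) / h)
    with (Series (fun n => (u (t + h) n - u t n) / h)); [exact He|].
  unfold Rdiv. rewrite Series_scal_r. f_equal.
  (* Summability is given at [t] only; the dominated increments transport it to [t + h]. *)
  assert (Ht' : ex_series (u (t + h))).
  { apply (ex_series_ext (fun n => (u (t + h) n - u t n) + u t n)).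
    - intros n. unfold Rminus. rewrite Rplus_assoc, Rplus_opp_l. apply Rplus_0_r.
    - apply (ex_series_plus (K := R_AbsRing) (V := R_NormedModule)); [|exact Ht].
      apply Hex. now rewrite Rplus_minus_l. }
  now rewrite <- Series_minus.
Qed.

(** * Formal power series over R *)

Definition pshift (a : nat -> R) : nat -> R := fun n => a (S n).

(** Cauchy product, defined by peeling off the constant term of [a], so that the ring laws follow by
    induction on [n] with [a] general. The convolution sum is recovered in [pmul_sum]. *)
Fixpoint pmul (a b : nat -> R) (n : nat) : R :=
  match n with
  | O => a O * b O
  | S m => a O * b (S m) + pmul (pshift a) b m
  end.

Definition padd (a b : nat -> R) : nat -> R := fun n => a n + b n.
Definition popp (a : nat -> R) : nat -> R := fun n => - a n.
Definition psub (a b : nat -> R) : nat -> R := fun n => a n - b n.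
Definition pconst (c : R) : nat -> R := fun n => match n with O => c | S _ => 0 end.
Definition pX : nat -> R := fun n => match n with 1%nat => 1 | _ => 0 end.
Definition theta (a : nat -> R) : nat -> R := fun n => INR n * a n.

Declare Scope ps_scope.
Delimit Scope ps_scope with ps.
Notation "a + b" := (padd a b) : ps_scope.
Notation "a - b" := (psub a b) : ps_scope.
Notation "a * b" := (pmul a b) : ps_scope.
Notation "- a" := (popp a) : ps_scope.

Lemma pmul_ext_le (a a' b b' : nat -> R) (n : nat) :
  (forall k, (k <= n)%nat -> a k = a' k) -> (forall k, (k <= n)%nat -> b k = b' k) ->
  pmul a b n = pmul a' b' n.
Proof.
  revert a a'. induction n as [|n IH]; intros a a' Ha Hb; simpl.
  - now rewrite Ha, Hb by lia.
  - rewrite Ha, (Hb (S n)) by lia. f_equal. apply IH.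
    + intros k Hk. apply Ha. lia.
    + intros k Hk. apply Hb. lia.
Qed.

Lemma pmul_S_r (a b : nat -> R) (n : nat) :
  pmul a b (S n) = pmul a (pshift b) n + a (S n) * b O.
Proof.
  revert a. induction n as [|n IH]; intros a.
  - simpl. unfold pshift. ring.
  - change (pmul a b (S (S n))) with (a O * b (S (S n)) + pmul (pshift a) b (S n)).
    rewrite IH. simpl. unfold pshift at 4. unfold pshift. ring.
Qed.

Lemma pmul_comm (a b : nat -> R) : (a * b)%ps = (b * a)%ps.
Proof.
  apply functional_extensionality. intros n. revert a.
  induction n as [|n IH]; intros a.
  - simpl. ring.
  - rewrite (pmul_S_r b a). simpl. rewrite IH.
    change (pmul b (pshift a) n) with ((b * pshift a)%ps n). ring.
Qed.

Lemma pmul_plus_l (a b c : nat -> R) : ((a + b) * c)%ps = (a * c + b * c)%ps.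
Proof.
  apply functional_extensionality. intros n. unfold padd. revert a b.
  induction n as [|n IH]; intros a b; simpl.
  - ring.
  - change (pshift (fun n => a n + b n)) with (fun n => pshift a n + pshift b n).
    rewrite IH. ring.
Qed.

Lemma pmul_scal_l (c : R) (a b : nat -> R) (n : nat) :
  pmul (fun k => c * a k) b n = c * pmul a b n.
Proof.
  revert a. induction n as [|n IH]; intros a; simpl.
  - ring.
  - change (pshift (fun n => c * a n)) with (fun n => c * pshift a n).
    rewrite IH. ring.
Qed.

Lemma pmul_assoc (a b c : nat -> R) : (a * (b * c))%ps = (a * b * c)%ps.
Proof.
  apply functional_extensionality. intros n. revert a.
  induction n as [|n IH]; intros a.
  - simpl. ring.
  - simpl.
    replace (pshift (a * b)%ps) with ((fun k => (a O * pshift b k)%R) + pshift a * b)%ps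
      by reflexivity.
    rewrite pmul_plus_l. unfold padd. rewrite pmul_scal_l, <- IH. ring.
Qed.

Lemma pmul_const (c : R) (a : nat -> R) (n : nat) : (pconst c * a)%ps n = c * a n.
Proof.
  assert (Z : forall m, pmul (pshift (pconst c)) a m = 0).
  { intros m. rewrite (pmul_ext_le _ (fun k => 0 * a k) _ a) by (intros; unfold pshift; simpl; ring).
    rewrite pmul_scal_l. ring. }
  destruct n; simpl; [|rewrite Z]; ring.
Qed.

Lemma pmul_1_l (a : nat -> R) : (pconst 1 * a)%ps = a.
Proof.
  apply functional_extensionality. intros n. rewrite pmul_const. ring.
Qed.

Lemma pmul_X_0 (a : nat -> R) : (pX * a)%ps O = 0.
Proof. simpl. ring. Qed.

Lemma pmul_X_S (a : nat -> R) (n : nat) : (pX * a)%ps (S n) = a n.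
Proof.
  simpl. replace (pshift pX) with (pconst 1).
  - change (pmul (pconst 1) a n) with ((pconst 1 * a)%ps n). rewrite pmul_1_l. ring.
  - apply functional_extensionality. now intros [|k].
Qed.

(** With coefficient sequences forming a commutative ring, identities in f, theta f and constants
    are left to [ring] once theta (theta f) has been rewritten by the differential equation. *)
Lemma ps_ring_theory :
  ring_theory (pconst 0) (pconst 1) padd pmul psub popp (@eq (nat -> R)).
Proof.
  constructor; intros;
    try (apply functional_extensionality; intros n; unfold padd, psub, popp, pconst;
         destruct n; ring).
  - apply pmul_1_l.
  - apply pmul_comm.
  - apply pmul_assoc.
  - apply pmul_plus_l.
Qed.

Add Ring ps_ring : ps_ring_theory.

Lemma theta_add (a b : nat -> R) : theta (a + b)%ps = (theta a + theta b)%ps.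
Proof. apply functional_extensionality; intros n; unfold theta, padd; ring. Qed.

Lemma theta_sub (a b : nat -> R) : theta (a - b)%ps = (theta a - theta b)%ps.
Proof. apply functional_extensionality; intros n; unfold theta, psub; ring. Qed.

Lemma theta_opp (a : nat -> R) : theta (- a)%ps = (- theta a)%ps.
Proof. apply functional_extensionality; intros n; unfold theta, popp; ring. Qed.

Lemma theta_const (c : R) : theta (pconst c) = pconst 0.
Proof. apply functional_extensionality; intros [|n]; unfold theta, pconst; simpl; ring. Qed.

Lemma theta_X : theta pX = pX.
Proof. apply functional_extensionality; intros [|[|n]]; unfold theta, pX; simpl; ring. Qed.

Lemma theta_mul (a b : nat -> R) : theta (a * b)%ps = (theta a * b + a * theta b)%ps.
Proof.
  apply functional_extensionality; intros n. unfold theta, padd. revert a.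
  induction n as [|n IH]; intros a; [simpl; ring|].
  change (pmul a b (S n)) with (a O * b (S n) + pmul (pshift a) b n).
  rewrite Rmult_plus_distr_l, S_INR, (Rmult_plus_distr_r _ _ (pmul _ _ _)), IH.
  change (pmul (fun n => INR n * a n) b (S n))
    with (INR 0 * a O * b (S n) + pmul (pshift (fun n => INR n * a n)) b n).
  change (pmul a (fun n => INR n * b n) (S n))
    with (a O * (INR (S n) * b (S n)) + pmul (pshift a) (fun n => INR n * b n) n).
  replace (pmul (pshift (fun n => INR n * a n)) b n)
    with (pmul ((fun n => (INR n * pshift a n)%R) + pshift a)%ps b n).
  - rewrite pmul_plus_l. unfold padd. rewrite S_INR. simpl INR. ring.
  - apply pmul_ext_le; [|reflexivity]. intros k _. unfold padd, pshift.
    rewrite S_INR. ring.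
Qed.

Hint Rewrite theta_add theta_sub theta_opp theta_const theta_X theta_mul : theta.

Lemma pconst_mul (c d : R) : pconst (c * d) = (pconst c * pconst d)%ps.
Proof.
  apply functional_extensionality; intros n. rewrite pmul_const.
  destruct n; simpl; ring.
Qed.

Lemma pconst_add (c d : R) : pconst (c + d) = (pconst c + pconst d)%ps.
Proof. apply functional_extensionality; intros [|n]; unfold padd, pconst; ring. Qed.

Lemma theta_0_const (a : nat -> R) : theta a = pconst 0 -> a = pconst (a O).
Proof.
  intros H. apply functional_extensionality; intros [|n]; [reflexivity|].
  apply (f_equal (fun u => u (S n))) in H. unfold theta, pconst in H.
  apply Rmult_integral in H. destruct H as [H|H]; [|exact H].
  now apply not_0_INR in H.
Qed.

(** * The reduced Bessel series *)

Fixpoint rising (a : R) (n : nat) : R :=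
  match n with
  | O => 1
  | S m => rising a m * (a + INR m)
  end.

Lemma rising_neq_0 (a : R) (n : nat) :
  (forall j, a + INR j <> 0) -> rising a n <> 0.
Proof.
  intros H. induction n as [|n IH]; simpl; [apply R1_neq_R0|].
  now apply Rmult_integral_contrapositive_currified.
Qed.

(* [BesselJ nu z = (z / 2) ^ nu / Gamma (nu + 1)] times the sum of [bes nu] at [(z / 2) ^ 2]. *)
Definition bes (nu : R) (n : nat) : R :=
  (-1) ^ n / (INR (fact n) * rising (nu + 1) n).

(** Logarithmic derivative of [rising a n] in [a]. Hence [dbes] is the derivative of [bes] in the
    order, in a purely algebraic form; see [is_derive_bes]. *)
Fixpoint harm (a : R) (n : nat) : R :=
  match n with
  | O => 0
  | S m => harm a m + / (a + INR m)
  end.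

Definition dbes (nu : R) (n : nat) : R := - bes nu n * harm (nu + 1) n.

Lemma INR_fact_S (n : nat) : INR (fact (S n)) = INR (S n) * INR (fact n).
Proof. rewrite <- mult_INR. reflexivity. Qed.

Lemma bes_S (nu : R) (n : nat) : (forall j, nu + 1 + INR j <> 0) ->
  INR (S n) * (INR (S n) + nu) * bes nu (S n) = - bes nu n.
Proof.
  intros H. unfold bes. rewrite INR_fact_S, <- tech_pow_Rmult.
  change (rising (nu + 1) (S n)) with (rising (nu + 1) n * (nu + 1 + INR n)).
  generalize (rising_neq_0 (nu + 1) n H) (H n) (INR_fact_neq_0 n) (not_0_INR (S n) ltac:(lia)).
  rewrite S_INR. intros. field. repeat split; auto.
Qed.

Lemma bes_ode (nu : R) : (forall j, nu + 1 + INR j <> 0) ->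
  theta (theta (bes nu)) = (- (pX * bes nu) - pconst nu * theta (bes nu))%ps.
Proof.
  intros H. apply functional_extensionality; intros [|n];
    unfold psub, popp; rewrite pmul_const; unfold theta.
  - rewrite pmul_X_0. simpl. ring.
  - rewrite pmul_X_S, <- (bes_S nu n H). ring.
Qed.

(** This is [bes_ode] differentiated in the order, checked on coefficients: the last summand of
    [harm] produces the source term. *)
Lemma dbes_ode (nu : R) : (forall j, nu + 1 + INR j <> 0) ->
  theta (theta (dbes nu))
  = (- (pX * dbes nu) - pconst nu * theta (dbes nu) - theta (bes nu))%ps.
Proof.
  intros H. apply functional_extensionality; intros [|n];
    unfold psub, popp; rewrite pmul_const; unfold theta.
  - rewrite pmul_X_0. simpl. ring.
  - rewrite pmul_X_S. unfold dbes.
    generalize (bes_S nu n H). simpl harm. intros E.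
    replace (bes nu n) with (- (INR (S n) * (INR (S n) + nu) * bes nu (S n))) by lra.
    clear E. generalize (H n). rewrite S_INR. intros. field. exact H0.
Qed.

Lemma bes_ode_unique (nu : R) (g k s : nat -> R) :
  (forall j, nu + 1 + INR j <> 0) ->
  theta (theta g) = (- (pX * g) - pconst nu * theta g - s)%ps ->
  theta (theta k) = (- (pX * k) - pconst nu * theta k - s)%ps ->
  g O = k O -> g = k.
Proof.
  intros H Hg Hk H0. apply functional_extensionality. intros n.
  induction n as [|n IH]; [exact H0|].
  apply (f_equal (fun u => u (S n))) in Hg, Hk.
  unfold psub, popp in Hg, Hk. rewrite pmul_const, pmul_X_S in Hg, Hk.
  unfold theta in Hg, Hk. rewrite IH in Hg.
  apply Rmult_eq_reg_l with (INR (S n) * (INR (S n) + nu)).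
  - lra.
  - apply Rmult_integral_contrapositive_currified.
    + apply not_0_INR. lia.
    + rewrite S_INR. replace (INR n + 1 + nu) with (nu + 1 + INR n) by ring. apply H.
Qed.

Definition nonint (nu : R) : Prop := forall m : Z, nu <> IZR m.

Lemma nonint_opp (nu : R) : nonint nu -> nonint (- nu).
Proof. intros H m E. apply (H (- m)%Z). rewrite opp_IZR. lra. Qed.

Lemma nonint_shift (nu : R) (m : Z) : nonint nu -> nu + IZR m <> 0.
Proof. intros H E. apply (H (- m)%Z). rewrite opp_IZR. lra. Qed.

Lemma nonint_shift_nat (nu : R) (m : Z) (j : nat) : nonint nu -> nu + IZR m + INR j <> 0.
Proof.
  intros H. rewrite INR_IZR_INZ, Rplus_assoc, <- plus_IZR. now apply nonint_shift.
Qed.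

Lemma nonint_shift_nat1 (nu : R) (j : nat) : nonint nu -> nu + 1 + INR j <> 0.
Proof. exact (nonint_shift_nat nu 1 j). Qed.

Section BesselProducts.

Context (nu : R) (Hnu : nonint nu).

Let f := bes nu.
Let h := bes (- nu).

Lemma bes_0 (mu : R) : bes mu 0 = 1.
Proof. unfold bes; simpl; field. Qed.

Let Hf : theta (theta f) = (- (pX * f) - pconst nu * theta f)%ps.
Proof. apply bes_ode. intros j. now apply nonint_shift_nat1. Qed.

Let Hh : theta (theta h) = (- (pX * h) + pconst nu * theta h)%ps.
Proof.
  unfold h at 1. rewrite bes_ode.
  - replace (pconst (- nu)) with (- pconst nu)%ps.
    + fold h. ring.
    + apply functional_extensionality; intros [|n]; unfold popp, pconst; ring.
  - intros j. apply nonint_shift_nat1. now apply nonint_opp.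
Qed.

(** Up to the factor - x^nu this is the Wronskian of f_nu and x^(-nu) f_{-nu}. The two differential
    equations make theta annihilate it, so it equals its constant term. *)
Lemma bes_wronskian :
  (bes (- nu) * theta (bes nu) - bes nu * theta (bes (- nu))
   + pconst nu * (bes nu * bes (- nu)))%ps = pconst nu.
Proof.
  fold f h.
  rewrite (theta_0_const (h * theta f - f * theta h + pconst nu * (f * h))%ps).
  - unfold padd, psub. rewrite pmul_const. simpl. unfold theta. simpl.
    unfold f, h. rewrite !bes_0. f_equal. ring.
  - autorewrite with theta. rewrite Hf, Hh. ring.
Qed.

(** f_nu^2 and x^(-nu) f_nu f_{-nu} both solve the symmetric square, of order three, of the equation
    of f_nu. Removing x^(-nu) replaces theta by theta - nu, which gives the form stated here. *)
Lemma theta_bes_mul_opp :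
  let u := (bes nu * bes (- nu))%ps in
  theta (theta (theta u))
  = (pconst (nu ^ 2) * theta u - pX * (pconst 4 * theta u + pconst 2 * u))%ps.
Proof.
  fold f h. cbv zeta.
  generalize bes_wronskian. fold f h. intros HW.
  assert (H1 : theta (f * h)%ps = (h * theta f + f * theta h)%ps).
  { autorewrite with theta. ring. }
  assert (H2 : theta (theta (f * h)%ps)
     = (pconst (nu ^ 2) * (f * h) - pconst (nu ^ 2) - pconst 2 * (pX * (f * h))
        + pconst 2 * (theta f * theta h))%ps).
  { rewrite H1. autorewrite with theta. rewrite Hf, Hh.
    replace (nu ^ 2) with (nu * nu) by ring. replace 2 with (1 + 1) by ring.
    rewrite pconst_mul, pconst_add.
    (* The occurrence replaced is the nu^2 that does not multiply f h; the Wronskian converts it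
       into the first-order terms produced by theta (theta (f h)). *)
    replace (pconst nu * pconst nu)%ps with (pconst nu * (h * theta f - f * theta h
   + pconst nu * (f * h)))%ps at 2 by (now rewrite HW).
    ring. }
  rewrite H2. autorewrite with theta. rewrite Hf, Hh.
  replace 4 with (2 + 2) by ring. replace 2 with (1 + 1) by ring. rewrite !pconst_add.
  ring.
Qed.

Lemma dbes_formula (A G : nat -> R) :
  A O = 1 -> G O = 0 ->
  theta A = (pconst nu * (bes nu * bes nu) - pconst nu * A)%ps ->
  theta G = (pconst (/ 2) * (pconst 1 - bes nu * bes (- nu)))%ps ->
  dbes nu = (bes nu * (pconst (1 / (2 * nu)) - G)
             - pconst (1 / (2 * nu)) * (bes (- nu) * A))%ps.
Proof.
  intros HA0 HG0 HA HG. fold f h in HA, HG |- *.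
  assert (Hn0 : nu <> 0) by (intros E; now apply (Hnu 0%Z)).
  apply (bes_ode_unique nu _ _ (theta f)).
  - intros j. now apply nonint_shift_nat1.
  - apply dbes_ode. intros j. now apply nonint_shift_nat1.
  (* The constants become atoms for [ring], related only by v c = t and t + t = 1. *)
  - set (c := pconst (1 / (2 * nu))). set (v := pconst nu) in *.
    set (t := pconst (/ 2)) in *.
    assert (Hc : (v * c = t)%ps).
    { unfold v, c, t. rewrite <- pconst_mul. f_equal. field. exact Hn0. }
    assert (Ht : (t + t)%ps = pconst 1).
    { apply functional_extensionality; intros [|n]; unfold padd, t, pconst; field. }
    generalize bes_wronskian. fold f h v. intros HW.
    assert (Hdc : theta c = pconst 0) by apply theta_const.
    assert (Hdt : theta t = pconst 0) by apply theta_const.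
    assert (H1 : theta (f * (c - G) - c * (h * A))%ps
       = (theta f * (c - G) - t * f - c * (theta h * A) + t * (h * A))%ps).
    { autorewrite with theta. rewrite HA, HG, Hdc. ring [Hc]. }
    rewrite H1. autorewrite with theta. rewrite Hf, Hh, HA, HG, Hdc, Hdt.
    (* The last two summands are zero, by the Wronskian and by t + t = 1. Adding them explicitly
       reduces the rest to an identity that needs only v c = t. *)
    transitivity (- (pX * (f * (c - G) - c * (h * A)))
       - v * (theta f * (c - G) - t * f - c * (theta h * A) + t * (h * A)) - theta f
       + t * f * ((h * theta f - f * theta h + v * (f * h)) - v)
       + (pconst 1 - (t + t)) * theta f)%ps.
    + ring [Hc].
    + rewrite HW, Ht. ring.
  - unfold dbes, psub. rewrite pmul_const. simpl. unfold psub, pconst.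
    rewrite HA0, HG0. unfold f, h. rewrite !bes_0. ring.
Qed.

End BesselProducts.

(** * Coefficients of f_nu^2 and f_nu f_{-nu}, and the series A and G *)

Lemma theta_bes_sq (nu : R) : (forall j, nu + 1 + INR j <> 0) ->
  let u := (bes nu * bes nu)%ps in
  theta (theta (theta u))
  = (- (pconst (3 * nu) * theta (theta u)) - pconst (2 * nu ^ 2) * theta u
     - pX * (pconst 4 * theta u + pconst (2 + 4 * nu) * u))%ps.
Proof.
  intros H. generalize (bes_ode nu H). set (f := bes nu). intros Hf. cbv zeta.
  autorewrite with theta. rewrite Hf. autorewrite with theta. rewrite Hf.
  replace 3 with (1 + 1 + 1) by ring. replace 4 with (2 + 2) by ring.
  replace 2 with (1 + 1) by ring. replace (nu ^ 2) with (nu * nu) by ring.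
  rewrite ?pconst_add, ?pconst_mul, ?pconst_add.
  ring.
Qed.

(** The part of the third-order equation free of x factors as theta (theta + nu) (theta + 2 nu), and
    the rest is x times a first-order operator. The recurrence therefore has two terms, which is
    what makes the square hypergeometric. *)
Lemma bes_sq_S (nu : R) (n : nat) : (forall j, nu + 1 + INR j <> 0) ->
  INR (S n) * (INR (S n) + nu) * (INR (S n) + 2 * nu) * (bes nu * bes nu)%ps (S n)
  = - (4 * INR n + 2 + 4 * nu) * (bes nu * bes nu)%ps n.
Proof.
  intros H. generalize (f_equal (fun u => u (S n)) (theta_bes_sq nu H)). cbv zeta beta.
  unfold psub, popp. rewrite pmul_X_S, !pmul_const. unfold padd. rewrite !pmul_const.
  unfold theta. set (u := (bes nu * bes nu)%ps). intros E.
  rewrite S_INR in *. lra.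
Qed.

Lemma bes_sq_closed (nu : R) (n : nat) :
  (forall j, nu + 1 + INR j <> 0) -> (forall j, 2 * nu + 1 + INR j <> 0) ->
  (bes nu * bes nu)%ps n
  = rising (nu + 1 / 2) n * (-4) ^ n
    / (rising (nu + 1) n * rising (2 * nu + 1) n * INR (fact n)).
Proof.
  intros H H2. induction n as [|n IH].
  - simpl. rewrite bes_0. field.
  - generalize (bes_sq_S nu n H). rewrite IH, INR_fact_S, <- tech_pow_Rmult. cbn [rising].
    generalize (rising_neq_0 (nu + 1) n H) (rising_neq_0 (2 * nu + 1) n H2) (H n) (H2 n)
      (INR_fact_neq_0 n) (not_0_INR (S n) ltac:(lia)).
    rewrite S_INR. intros P1 P2 P3 P4 P5 P6 E.
    assert (P7 : (INR n + 1) * (INR n + 1 + nu) * (INR n + 1 + 2 * nu) <> 0).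
    { repeat apply Rmult_integral_contrapositive_currified; [exact P6| |]; intros Q;
        [apply P3|apply P4]; lra. }
    apply (Rmult_eq_reg_l _ _ _) with (2 := P7). rewrite E. field. repeat split; assumption.
Qed.

Lemma bes_mul_opp_S (nu : R) (n : nat) : nonint nu ->
  INR (S n) * (INR (S n) ^ 2 - nu ^ 2) * (bes nu * bes (- nu))%ps (S n)
  = - (4 * INR n + 2) * (bes nu * bes (- nu))%ps n.
Proof.
  intros H. generalize (f_equal (fun u => u (S n)) (theta_bes_mul_opp nu H)). cbv zeta beta.
  unfold psub. rewrite pmul_X_S, !pmul_const. unfold padd. rewrite !pmul_const.
  unfold theta. set (u := (bes nu * bes (- nu))%ps). intros E. lra.
Qed.

Lemma rising_shift (a : R) (n : nat) : rising a n * (a + INR n) = a * rising (a + 1) n.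
Proof.
  induction n as [|n IH]; [simpl; ring|].
  cbn [rising]. rewrite IH, S_INR. ring.
Qed.

(** Dividing by [nu + INR n] inverts theta + nu. In contrast to the 2F3 coefficients of
    [besA_closed], this form has no denominators 2 nu + j, so it stays meaningful and continuous at
    half-integers. *)
Definition besA (nu : R) (n : nat) : R := nu * (bes nu * bes nu)%ps n / (nu + INR n).

Lemma theta_besA (nu : R) : nonint nu ->
  theta (besA nu) = (pconst nu * (bes nu * bes nu) - pconst nu * besA nu)%ps.
Proof.
  intros H. apply functional_extensionality. intros n.
  unfold psub. rewrite !pmul_const. unfold theta, besA.
  generalize ((bes nu * bes nu)%ps n). intros u. field.
  rewrite INR_IZR_INZ. now apply nonint_shift.
Qed.

Lemma besA_closed (nu : R) (n : nat) :
  nonint nu -> (forall j, 2 * nu + 1 + INR j <> 0) ->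
  rising nu n * (rising (nu + 1 / 2) n * 1)
    / (rising (nu + 1) n * (rising (nu + 1) n * (rising (2 * nu + 1) n * 1)))
    * (-4) ^ n / INR (fact n) = besA nu n.
Proof.
  intros H H2.
  assert (Hn : nu + INR n <> 0) by (rewrite INR_IZR_INZ; now apply nonint_shift).
  assert (H1 : forall j, nu + 1 + INR j <> 0) by (intros j; now apply nonint_shift_nat1).
  unfold besA. rewrite bes_sq_closed by assumption.
  replace (rising nu n) with (nu * rising (nu + 1) n / (nu + INR n))
    by (rewrite <- rising_shift; field; exact Hn).
  generalize (rising_neq_0 (nu + 1) n H1) (rising_neq_0 (2 * nu + 1) n H2)
      (INR_fact_neq_0 n). intros. field. repeat split; assumption.
Qed.

Definition besG (nu : R) (n : nat) : R :=
  match n with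
  | O => 0
  | S _ => - (bes nu * bes (- nu))%ps n / (2 * INR n)
  end.

Lemma theta_besG (nu : R) :
  theta (besG nu) = (pconst (/ 2) * (pconst 1 - bes nu * bes (- nu)))%ps.
Proof.
  apply functional_extensionality. intros n. rewrite pmul_const. unfold psub, theta, besG.
  destruct n as [|n].
  - simpl. rewrite !bes_0. ring.
  - unfold pconst. generalize ((bes nu * bes (- nu))%ps (S n)). intros u. field.
    apply not_0_INR. lia.
Qed.

(** G has no constant term, so it is x times a series, whence the factor in front of the 3F4. The
    recurrence of f_nu f_{-nu} and the division by [INR n] in [besG] give the two lower parameters
    2; one upper parameter 1 comes from that division, the other only cancels the factorial. *)
Lemma besG_closed (nu : R) (n : nat) : nonint nu ->
  / (1 - nu ^ 2) * (rising 1 n * (rising 1 n * (rising (3 / 2) n * 1))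
    / (rising 2 n * (rising 2 n * (rising (2 - nu) n * (rising (2 + nu) n * 1)))))
    * (-4) ^ n / INR (fact n) = besG nu (S n).
Proof.
  intros H. unfold besG.
  assert (Hp : forall j, nu + INR j <> 0).
  { intros j. rewrite INR_IZR_INZ. now apply nonint_shift. }
  assert (Hm : forall j, - nu + INR j <> 0).
  { intros j. rewrite INR_IZR_INZ. now apply nonint_shift, nonint_opp. }
  induction n as [|n IH].
  - generalize (bes_mul_opp_S nu 0 H). simpl (INR 1). simpl (INR 0).
    cbn [rising]. replace ((bes nu * bes (- nu))%ps O) with 1 by (simpl; rewrite !bes_0; ring).
    generalize (Hp 1%nat) (Hm 1%nat). simpl (INR 1). intros P1 P2 E.
    assert (P3 : 1 - nu ^ 2 <> 0).
    { replace (1 - nu ^ 2) with ((nu + 1) * (- nu + 1)) by ring.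
      now apply Rmult_integral_contrapositive_currified. }
    replace ((bes nu * bes (- nu))%ps 1%nat) with (- 2 / (1 - nu ^ 2)).
    + simpl. field. intros Q. apply P3. lra.
    + apply Rmult_eq_reg_l with (1 - nu ^ 2); [|exact P3].
      transitivity (-2); [field; exact P3|]. lra.
  - generalize (bes_mul_opp_S nu (S n) H). intros E.
    assert (P1 : INR (S n) <> 0) by (apply not_0_INR; lia).
    assert (P2 : INR (S (S n)) <> 0) by (apply not_0_INR; lia).
    generalize (Hp (S (S n))) (Hm (S (S n))). intros P3 P4.
    assert (P5 : INR (S (S n)) ^ 2 - nu ^ 2 <> 0).
    { replace (INR (S (S n)) ^ 2 - nu ^ 2)
        with ((nu + INR (S (S n))) * (- nu + INR (S (S n)))) by ring.
      now apply Rmult_integral_contrapositive_currified. }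
    replace ((bes nu * bes (- nu))%ps (S (S n)))
      with (- (4 * INR (S n) + 2) * (bes nu * bes (- nu))%ps (S n)
            / (INR (S (S n)) * (INR (S (S n)) ^ 2 - nu ^ 2)))
      by (rewrite <- E; field; auto).
    replace ((bes nu * bes (- nu))%ps (S n)) with
      (- (2 * INR (S n)) * (- (bes nu * bes (- nu))%ps (S n) / (2 * INR (S n))))
      by (field; auto).
    rewrite <- IH. clear IH E.
    assert (Q : forall a, (forall j, a + INR j <> 0) -> rising a n <> 0)
      by (intros; now apply rising_neq_0).
    assert (Q2 : rising 2 n <> 0) by (apply Q; intros j; generalize (pos_INR j); lra).
    assert (E2 : forall s j, s + 2 + INR j = s + INR (S (S j))) by (intros; rewrite !S_INR; ring).
    assert (Q3 : rising (2 - nu) n <> 0).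
    { apply Q. intros j. replace (2 - nu) with (- nu + 2) by ring. rewrite E2. apply Hm. }
    assert (Q4 : rising (2 + nu) n <> 0).
    { apply Q. intros j. rewrite (Rplus_comm 2), E2. apply Hp. }
    assert (P0 : 1 - nu ^ 2 <> 0).
    { generalize (Hp 1%nat) (Hm 1%nat). simpl (INR 1). intros.
      replace (1 - nu ^ 2) with ((nu + 1) * (- nu + 1)) by ring.
      now apply Rmult_integral_contrapositive_currified. }
    rewrite INR_fact_S, <- (tech_pow_Rmult (-4) n). cbn [rising].
    rewrite !S_INR in *.
    generalize (INR_fact_neq_0 n). intros Q5. field.
    repeat split; auto; try lra; intros QQ; first [apply P3; lra | apply P4; lra | apply P5; lra].
Qed.

Lemma dbes_eq (nu : R) : nonint nu ->
  dbes nu = (bes nu * (pconst (1 / (2 * nu)) - besG nu)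
             - pconst (1 / (2 * nu)) * (bes (- nu) * besA nu))%ps.
Proof.
  intros H. apply dbes_formula.
  - exact H.
  - unfold besA. simpl. rewrite !bes_0. field. intros E. now apply (H 0%Z).
  - reflexivity.
  - now apply theta_besA.
  - apply theta_besG.
Qed.

Lemma besG_opp (nu : R) : besG (- nu) = besG nu.
Proof.
  apply functional_extensionality. intros [|n]; [reflexivity|].
  unfold besG. now rewrite Ropp_involutive, pmul_comm.
Qed.

(** * The gamma function *)

Definition gauss_seq (x : R) (n : nat) : R :=
  INR (fact n) * Rpower (INR n) x / gauss_prod x n.

Lemma is_lim_seq_inv_INR_S : is_lim_seq (fun n => / INR (S n)) 0.
Proof.
  replace (Finite 0) with (Rbar_inv p_infty) by reflexivity.
  apply is_lim_seq_inv; [|discriminate].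
  apply (proj1 (is_lim_seq_incr_1 INR p_infty)). exact is_lim_seq_INR.
Qed.

Lemma ex_series_inv_sq : ex_series (fun n => / INR (S n) ^ 2).
Proof.
  (* The majorant is 2 / ((n + 1) (n + 2)), which telescopes; it dominates because n + 2 <= 2 (n +
     1). *)
  apply (ex_series_Rle _ (fun n => 2 * (/ INR (S n) - / INR (S (S n))))).
  - intros n. rewrite Rabs_pos_eq.
    + generalize (pos_INR n). rewrite !S_INR. intros H.
      apply Rminus_le_0.
      replace (_ - _) with (INR n / ((INR n + 1) ^ 2 * (INR n + 1 + 1)))
        by (field; split; lra).
      apply Rdiv_le_0_compat; [exact H|].
      apply Rmult_lt_0_compat; [apply pow_lt|]; lra.
    + apply Rlt_le, Rinv_0_lt_compat, pow_lt, lt_0_INR. lia.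
  - apply (ex_series_Rscal 2). exists 1.
    change (is_lim_seq (sum_n (fun n => / INR (S n) - / INR (S (S n)))) 1).
    apply (is_lim_seq_ext (fun n => 1 - / INR (S (S n)))).
    + intros n. induction n as [|n IH].
      * rewrite sum_O. simpl. field.
      * rewrite sum_Sn, <- IH. unfold plus. simpl AbelianMonoid.plus.
        change (1 - / INR (S (S (S n)))
          = 1 - / INR (S (S n)) + (/ INR (S (S n)) - / INR (S (S (S n))))).
        ring.
    + replace (Finite 1) with (Finite (1 - 0)) by (f_equal; ring).
      apply is_lim_seq_minus'; [apply is_lim_seq_const|].
      apply (proj1 (is_lim_seq_incr_1 (fun n => / INR (S n)) 0)).
      exact is_lim_seq_inv_INR_S.
Qed.

Lemma ln_le_sub_1 (y : R) : 0 < y -> ln y <= y - 1.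
Proof.
  intros H. generalize (exp_ineq1_le (ln y)). rewrite exp_ln by exact H. lra.
Qed.

Lemma ln_sub_bounds (a b : R) : 0 < a -> 0 < b -> (b - a) / b <= ln b - ln a <= (b - a) / a.
Proof.
  intros Ha Hb. split.
  - generalize (ln_le_sub_1 (a / b) (Rdiv_lt_0_compat _ _ Ha Hb)).
    rewrite ln_div by assumption. intros H.
    replace ((b - a) / b) with (1 - a / b) by (field; lra). lra.
  - generalize (ln_le_sub_1 (b / a) (Rdiv_lt_0_compat _ _ Hb Ha)).
    rewrite ln_div by assumption. intros H.
    replace ((b - a) / a) with (b / a - 1) by (field; lra). lra.
Qed.

(* The summands come from writing the logarithm of Gauss' sequence as a telescoping sum. *)
Definition lgamma_term (x : R) (n : nat) : R :=
  x * (ln (INR (S (S n))) - ln (INR (S n))) - (ln (x + INR (S n)) - ln (INR (S n))).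

Definition dlgamma_term (x : R) (n : nat) : R :=
  ln (INR (S (S n))) - ln (INR (S n)) - / (x + INR (S n)).

(** For [x > 0] this is the logarithm of Gamma (x + 1), by [Gamma_exp] and [Gamma_succ]. *)
Definition lgamma1 (x : R) : R := Series (lgamma_term x).

Lemma ln_INR_S_bounds (n : nat) :
  / INR (S (S n)) <= ln (INR (S (S n))) - ln (INR (S n)) <= / INR (S n).
Proof.
  generalize (ln_sub_bounds (INR (S n)) (INR (S (S n)))
    ltac:(apply lt_0_INR; lia) ltac:(apply lt_0_INR; lia)).
  rewrite (S_INR (S n)). intros [H1 H2]. split.
  - eapply Rle_trans; [|exact H1]. right. unfold Rdiv. ring.
  - eapply Rle_trans; [exact H2|]. right. unfold Rdiv. ring.
Qed.

Lemma inv_sub_inv_le (x : R) (n : nat) : 0 < x ->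
  0 <= / INR (S n) - / (x + INR (S n)) <= x * / INR (S n) ^ 2
  /\ 0 <= / INR (S n) - / INR (S (S n)) <= / INR (S n) ^ 2.
Proof.
  assert (G : forall y, 0 < y -> 0 <= / INR (S n) - / (y + INR (S n)) <= y * / INR (S n) ^ 2).
  { intros y Hy. assert (0 < INR (S n)) by (apply lt_0_INR; lia).
    replace (/ INR (S n) - / (y + INR (S n))) with (y * / (INR (S n) * (y + INR (S n))))
      by (field; lra).
    split.
    - apply Rmult_le_pos; [lra|]. apply Rlt_le, Rinv_0_lt_compat.
      apply Rmult_lt_0_compat; lra.
    - apply Rmult_le_compat_l; [lra|]. apply Rinv_le_contravar.
      + now apply pow_lt.
      + rewrite <- Rsqr_pow2. apply Rmult_le_compat_l; lra. }
  intros Hx. split; [now apply G|].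
  rewrite (S_INR (S n)), (Rplus_comm _ 1). generalize (G 1 Rlt_0_1). now rewrite Rmult_1_l.
Qed.

(** Both differences in [lgamma_term] are x / (n + 1) up to an error of order 1 / (n + 1)^2, so the
    leading parts cancel. *)
Lemma lgamma_term_le (x : R) (n : nat) : 0 < x ->
  Rabs (lgamma_term x n) <= (x * x + x) * / INR (S n) ^ 2.
Proof.
  intros Hx. assert (Hn : 0 < INR (S n)) by (apply lt_0_INR; lia).
  destruct (inv_sub_inv_le x n Hx) as [[A1 A2] [A3 A4]].
  destruct (ln_INR_S_bounds n) as [B1 B2].
  destruct (ln_sub_bounds (INR (S n)) (x + INR (S n)) Hn ltac:(lra)) as [C1 C2].
  unfold lgamma_term, Rdiv in *. rewrite Rplus_minus_r in C1, C2.
  apply (Rmult_le_compat_l x) in A1, A2, A3, A4, B1, B2; try lra.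
  apply Rabs_le. split; lra.
Qed.

Lemma dlgamma_term_le (x : R) (n : nat) : 0 < x ->
  Rabs (dlgamma_term x n) <= (x + 1) * / INR (S n) ^ 2.
Proof.
  intros Hx. destruct (inv_sub_inv_le x n Hx) as [[A1 A2] [A3 A4]].
  destruct (ln_INR_S_bounds n) as [B1 B2]. unfold dlgamma_term.
  apply Rabs_le. split; lra.
Qed.

Lemma ex_series_lgamma_term (x : R) : 0 < x -> ex_series (lgamma_term x).
Proof.
  intros Hx. apply (ex_series_Rle _ (fun n => (x * x + x) * / INR (S n) ^ 2)).
  - intros n. now apply lgamma_term_le.
  - apply (ex_series_Rscal (x * x + x)). exact ex_series_inv_sq.
Qed.

Lemma is_derive_lgamma1 (x : R) : 0 < x -> is_derive lgamma1 x (Series (dlgamma_term x)).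
Proof.
  intros Hx.
  assert (Hin : forall s, Rabs (s - x) < x -> 0 < s < 2 * x).
  { intros s H. apply Rabs_def2 in H. lra. }
  apply (is_derive_Series lgamma_term dlgamma_term x x
           (fun n => (2 * x + 1) * / INR (S n) ^ 2)); [exact Hx| | | |].
  - intros n s Hs. apply Hin in Hs. unfold lgamma_term, dlgamma_term.
    assert (0 < INR (S n)) by (apply lt_0_INR; lia).
    generalize (ln (INR (S (S n)))). revert H. generalize (INR (S n)).
    intros r Hr q. auto_derive; [lra|]. field. lra.
  - intros n s Hs. apply Hin in Hs. eapply Rle_trans; [apply dlgamma_term_le; lra|].
    apply Rmult_le_compat_r; [|lra].
    apply Rlt_le, Rinv_0_lt_compat, pow_lt, lt_0_INR. lia.
  - apply (ex_series_Rscal (2 * x + 1)). exact ex_series_inv_sq.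
  - now apply ex_series_lgamma_term.
Qed.

Lemma gauss_prod_neq_0 (x : R) (n : nat) :
  (forall j, x + INR j <> 0) -> gauss_prod x n <> 0.
Proof.
  intros H. induction n as [|n IH].
  - generalize (H O). simpl. now rewrite Rplus_0_r.
  - apply Rmult_integral_contrapositive_currified; [exact IH|apply H].
Qed.

(** Telescoping up to index [n] yields the power (n + 2)^x where Gauss' sequence has (n + 1)^x. The
    last exponential corrects this and tends to 1. *)
Lemma gauss_seq_exp (x : R) (n : nat) : 0 < x ->
  gauss_seq x (S n) = exp (sum_f_R0 (lgamma_term x) n) / x
    * exp (- x * (ln (INR (S (S n))) - ln (INR (S n)))).
Proof.
  intros Hx.
  assert (HP : forall j, x + INR j <> 0) by (intros j; generalize (pos_INR j); lra).
  assert (E : exp (sum_f_R0 (lgamma_term x) n)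
    = INR (fact (S n)) * Rpower (INR (S (S n))) x * x / gauss_prod x (S n)).
  { induction n as [|n IH].
    - simpl sum_f_R0. unfold lgamma_term. change (INR 1) with 1. rewrite ln_1, !Rminus_0_r.
      unfold Rminus. rewrite exp_plus, exp_Ropp, exp_ln by lra. simpl gauss_prod.
      change (INR 1) with 1. unfold Rpower. change (INR (fact 1)) with 1. field. lra.
    - change (sum_f_R0 (lgamma_term x) (S n))
        with (sum_f_R0 (lgamma_term x) n + lgamma_term x (S n)).
      rewrite exp_plus, IH. unfold lgamma_term, Rpower.
      change (gauss_prod x (S (S n))) with (gauss_prod x (S n) * (x + INR (S (S n)))).
      rewrite (INR_fact_S (S n)).
      set (N2 := INR (S (S n))). set (N3 := INR (S (S (S n)))).
      assert (0 < N2) by (apply lt_0_INR; lia).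
      replace (x * (ln N3 - ln N2) - (ln (x + N2) - ln N2))
        with (x * ln N3 + - (x * ln N2) + - ln (x + N2) + ln N2) by ring.
      rewrite !exp_plus, !exp_Ropp, !exp_ln by lra.
      generalize (gauss_prod_neq_0 x (S n) HP). intros HG.
      generalize (exp_pos (x * ln N2)). intros He.
      field. repeat split; try lra; exact HG. }
  rewrite E. unfold gauss_seq, Rpower.
  replace (- x * (ln (INR (S (S n))) - ln (INR (S n))))
    with (- (x * ln (INR (S (S n)))) + x * ln (INR (S n))) by ring.
  rewrite exp_plus, exp_Ropp.
  generalize (gauss_prod_neq_0 x (S n) HP) (exp_pos (x * ln (INR (S (S n))))). intros HG He.
  field. repeat split; try lra; exact HG.
Qed.

Lemma is_lim_gauss_seq_pos (x : R) : 0 < x ->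
  is_lim_seq (gauss_seq x) (exp (lgamma1 x) / x).
Proof.
  intros Hx. apply is_lim_seq_incr_1.
  apply (is_lim_seq_ext (fun n => exp (sum_f_R0 (lgamma_term x) n) / x
    * exp (- x * (ln (INR (S (S n))) - ln (INR (S n)))))).
  { intros n. now rewrite gauss_seq_exp. }
  replace (exp (lgamma1 x) / x) with (exp (lgamma1 x) * / x * exp (- x * 0))
    by (rewrite Rmult_0_r, exp_0; unfold Rdiv; ring).
  assert (Hexp : forall u l, is_lim_seq u (Finite l) ->
                        is_lim_seq (fun n => exp (u n)) (Finite (exp l))).
  { intros u l H. apply is_lim_seq_continuous; [|exact H].
    apply derivable_continuous_pt, derivable_pt_exp. }
  apply is_lim_seq_mult'; [apply is_lim_seq_mult'; [|apply is_lim_seq_const]|].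
  - apply Hexp.
    apply (is_lim_seq_ext (sum_n (lgamma_term x))).
    { intros n. apply sum_n_Reals. }
    apply (Series_correct (lgamma_term x)). now apply ex_series_lgamma_term.
  - apply Hexp. apply is_lim_seq_mult'; [apply is_lim_seq_const|].
    apply (is_lim_seq_le_le (fun n => 0) _ (fun n => / INR (S n))).
    + intros n. destruct (ln_INR_S_bounds n) as [B1 B2]. split; [|exact B2].
      eapply Rle_trans; [|exact B1].
      apply Rlt_le, Rinv_0_lt_compat, lt_0_INR. lia.
    + apply is_lim_seq_const.
    + exact is_lim_seq_inv_INR_S.
Qed.

Lemma gauss_prod_shift (x : R) (n : nat) :
  gauss_prod (x + 1) n * x = gauss_prod x n * (x + 1 + INR n).
Proof.
  induction n as [|n IH]; [simpl; ring|].
  change (gauss_prod (x + 1) n * (x + 1 + INR (S n)) * x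
          = gauss_prod x n * (x + INR (S n)) * (x + 1 + INR (S n))).
  replace (gauss_prod (x + 1) n * (x + 1 + INR (S n)) * x)
    with (gauss_prod (x + 1) n * x * (x + 1 + INR (S n))) by ring.
  rewrite IH, !S_INR. ring.
Qed.

(** The two sequences differ by the factor (x + 1 + n) / (x n), which tends to 1 / x. This carries
    convergence from the positive half-line to the left. *)
Lemma is_lim_gauss_seq_shift (x l : R) : x <> 0 ->
  is_lim_seq (gauss_seq (x + 1)) l -> is_lim_seq (gauss_seq x) (l / x).
Proof.
  intros Hx Hl.
  destruct (INR_unbounded (Rabs x)) as [N HN].
  apply (is_lim_seq_ext_loc (fun n => gauss_seq (x + 1) n
           * (/ x + (x + 1) * / x * / INR n))).
  - exists (S N). intros n Hn.
    assert (HNn : INR (S N) <= INR n) by now apply le_INR.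
    rewrite S_INR in HNn. generalize (pos_INR N). intros HN0.
    assert (Hxn : x + 1 + INR n <> 0).
    { generalize (Rle_abs (- x)). rewrite Rabs_Ropp. lra. }
    unfold gauss_seq. rewrite Rpower_plus, Rpower_1 by lra.
    generalize (gauss_prod_shift x n). intros E.
    (* At a pole the product vanishes for large [n]. Then so does the one for [x + 1], as [x <> 0],
       and both sides are 0 because [/ 0 = 0]. *)
    destruct (Req_dec (gauss_prod x n) 0) as [E0|E0].
    + rewrite E0 in E |- *. rewrite Rmult_0_l in E.
      apply Rmult_integral in E. destruct E as [E|E]; [|contradiction].
      rewrite E. unfold Rdiv. rewrite Rinv_0. ring.
    + replace (gauss_prod (x + 1) n) with (gauss_prod x n * (x + 1 + INR n) / x).
      * field. repeat split; auto; lra.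
      * rewrite <- E. field. exact Hx.
  - replace (Finite (l / x)) with (Finite (l * (/ x + (x + 1) * / x * 0)))
      by (f_equal; unfold Rdiv; ring).
    apply is_lim_seq_mult'; [exact Hl|].
    apply is_lim_seq_plus'; [apply is_lim_seq_const|].
    apply is_lim_seq_mult'; [apply is_lim_seq_const|].
    apply is_lim_seq_incr_1. exact is_lim_seq_inv_INR_S.
Qed.

(** Induction along unit steps to the left, matching the functional equation of Gamma. *)
Lemma pos_shift_ind (P : R -> Prop) :
  (forall x, 0 < x -> P x) -> (forall x, x <= 0 -> P (x + 1) -> P x) -> forall x, P x.
Proof.
  intros H0 H1 x. destruct (INR_unbounded (- x)) as [N HN]. revert x HN.
  induction N as [|N IH]; intros x HN.
  - apply H0. simpl in HN. lra.
  - destruct (Rle_dec x 0) as [Hx|Hx]; [|apply H0; lra].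
    apply H1; [exact Hx|]. apply IH. rewrite S_INR in HN. lra.
Qed.

Lemma is_lim_gauss_seq (x : R) : is_lim_seq (gauss_seq x) (Gamma x).
Proof.
  apply Lim_seq_correct'. revert x. apply pos_shift_ind.
  - intros x Hx. exists (exp (lgamma1 x) / x). now apply is_lim_gauss_seq_pos.
  (* The shift lemma excludes 0. There every product contains the factor 0, so the sequence is
     identically 0 by [/ 0 = 0]. *)
  - intros x _ [l Hl]. destruct (Req_dec x 0) as [->|Hx].
    + exists 0. apply (is_lim_seq_ext (fun _ => 0)); [|apply is_lim_seq_const].
      intros n. unfold gauss_seq.
      replace (gauss_prod 0 n) with 0; [unfold Rdiv; rewrite Rinv_0; ring|].
      induction n as [|n IH]; [reflexivity|]. simpl gauss_prod. rewrite <- IH. ring.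
    + exists (l / x). now apply is_lim_gauss_seq_shift.
Qed.

Lemma Gamma_unique (x l : R) : is_lim_seq (gauss_seq x) l -> Gamma x = l.
Proof. intros H. apply is_lim_seq_unique in H. change (real (Lim_seq (gauss_seq x)) = l). now rewrite H. Qed.

Lemma Gamma_exp (x : R) : 0 < x -> Gamma x = exp (lgamma1 x) / x.
Proof. intros H. now apply Gamma_unique, is_lim_gauss_seq_pos. Qed.

(* At the poles both sides are 0. *)
Lemma Gamma_succ (x : R) : x <> 0 -> Gamma (x + 1) = x * Gamma x.
Proof.
  intros H.
  rewrite (Gamma_unique x (Gamma (x + 1) / x)).
  - field. exact H.
  - apply is_lim_gauss_seq_shift; [exact H|]. apply is_lim_gauss_seq.
Qed.

Lemma Gamma_neq_0 (x : R) : (forall j, x + INR j <> 0) -> Gamma x <> 0.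
Proof.
  revert x. apply (pos_shift_ind (fun x => (forall j, x + INR j <> 0) -> Gamma x <> 0)).
  - intros x Hx _. rewrite Gamma_exp by exact Hx.
    apply Rgt_not_eq, Rdiv_lt_0_compat; [apply exp_pos|exact Hx].
  - intros x _ IH H E. apply IH.
    + intros j. rewrite Rplus_assoc, (Rplus_comm 1), <- S_INR. apply H.
    + rewrite Gamma_succ, E; [ring|]. generalize (H O). simpl. now rewrite Rplus_0_r.
Qed.

Lemma ex_derive_Gamma (x : R) : (forall j, x + INR j <> 0) -> ex_derive Gamma x.
Proof.
  revert x. apply (pos_shift_ind (fun x => (forall j, x + INR j <> 0) -> ex_derive Gamma x)).
  - intros x Hx _. apply (ex_derive_ext_loc (fun y => exp (lgamma1 y) / y)).
    + exists (mkposreal x Hx). intros y Hy. apply Rabs_def2 in Hy. simpl in Hy.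
      unfold minus, plus, opp in Hy. simpl in Hy. symmetry. apply Gamma_exp. lra.
    + assert (ex_derive lgamma1 x) by (eexists; now apply is_derive_lgamma1).
      auto_derive. repeat split; [assumption|lra].
  - intros x _ IH H.
    assert (Hx : x <> 0) by (generalize (H O); simpl; now rewrite Rplus_0_r).
    apply (ex_derive_ext_loc (fun y => Gamma (y + 1) / y)).
    + exists (mkposreal (Rabs x) (Rabs_pos_lt x Hx)). intros y Hy.
      assert (Hy0 : y <> 0).
      { intros ->. change (Rabs (0 - x) < Rabs x) in Hy.
        rewrite Rminus_0_l, Rabs_Ropp in Hy. lra. }
      rewrite Gamma_succ by exact Hy0. now apply Rmult_div_r.
    + assert (ex_derive Gamma (x + 1)).
      { apply IH. intros j. rewrite Rplus_assoc, (Rplus_comm 1), <- S_INR. apply H. }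
      auto_derive. repeat split; assumption.
Qed.

(** * The reflection formula *)

Lemma is_RInt_comb (a b : R) (f g : R -> R) (u v : R) :
  ex_RInt f u v -> ex_RInt g u v ->
  is_RInt (fun t => a * f t - b * g t) u v (a * RInt f u v - b * RInt g u v).
Proof.
  intros Hf Hg.
  apply (is_RInt_minus (V := R_NormedModule) (fun t => scal a (f t)) (fun t => scal b (g t)));
    apply (is_RInt_scal (V := R_NormedModule));
    now apply (RInt_correct (V := R_CompleteNormedModule)).
Qed.

(** Wallis integrals with an extra frequency 2 x. Each step from [k] to [k + 2] contributes one
    factor 1 - (x / n)^2 of Euler's product for the sine. *)
Definition cos_int (k : nat) (x : R) : R :=
  RInt (fun t => cos (2 * x * t) * cos t ^ k) 0 (PI / 2).

Lemma ex_RInt_cos_int (k : nat) (x : R) :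
  ex_RInt (fun t => cos (2 * x * t) * cos t ^ k) 0 (PI / 2).
Proof.
  apply (ex_RInt_continuous (V := R_CompleteNormedModule)). intros t _.
  apply (ex_derive_continuous (V := R_NormedModule)). auto_derive. exact I.
Qed.

Lemma cos_int_rec (k : nat) (x : R) :
  (INR (k + 2) ^ 2 - 4 * x ^ 2) * cos_int (k + 2) x
  = INR (k + 2) * INR (k + 1) * cos_int k x.
Proof.
  set (N := INR (k + 2)).
  (* Antiderivative found by integrating by parts twice. It vanishes at 0 because of the sines and
     at [PI / 2] because of the positive powers of the cosine. *)
  set (F := fun t => N * (cos t ^ S k * sin t * cos (2 * x * t))
                     - 2 * x * (cos t ^ S (S k) * sin (2 * x * t))).
  assert (HF : is_RInt (fun t => (N ^ 2 - 4 * x ^ 2) * (cos (2 * x * t) * cos t ^ (k + 2))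
                    - N * INR (k + 1) * (cos (2 * x * t) * cos t ^ k)) 0 (PI / 2) 0).
  { replace 0 with (minus (F (PI / 2)) (F 0)) at 2.
    - apply (is_RInt_derive (V := R_CompleteNormedModule) F).
      + intros t _. unfold F. auto_derive; [exact I|].
        replace (k + 2)%nat with (S (S k)) by lia. replace (k + 1)%nat with (S k) by lia.
        generalize (sin2_cos2 t). unfold Rsqr. intros E.
        assert (E2 : sin t * sin t = 1 - cos t * cos t) by lra.
        unfold N. rewrite !plus_INR. simpl (INR 2).
        replace (match k with O => 1 | S _ => INR k + 1 end) with (INR k + 1)
          by (destruct k; simpl; ring).
        rewrite S_INR, <- !tech_pow_Rmult. ring [E2].
      + intros t _.
        apply (ex_derive_continuous (V := R_NormedModule)).
        auto_derive. exact I.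
    - unfold F, minus, plus, opp; simpl. rewrite cos_PI2, !Rmult_0_r, sin_0. ring. }
  apply (is_RInt_unique (V := R_CompleteNormedModule)) in HF.
  generalize (is_RInt_unique (V := R_CompleteNormedModule) _ _ _ _
    (is_RInt_comb (N ^ 2 - 4 * x ^ 2) (N * INR (k + 1)) _ _ _ _
       (ex_RInt_cos_int (k + 2) x) (ex_RInt_cos_int k x))).
  fold (cos_int (k + 2) x) (cos_int k x). rewrite HF. lra.
Qed.

Lemma cos_int_0_l (x : R) : x <> 0 -> cos_int 0 x = sin (PI * x) / (2 * x).
Proof.
  intros Hx. apply (is_RInt_unique (V := R_CompleteNormedModule)).
  replace (sin (PI * x) / (2 * x))
    with (minus (sin (2 * x * (PI / 2)) / (2 * x)) (sin (2 * x * 0) / (2 * x))).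
  - apply (is_RInt_derive (V := R_CompleteNormedModule) (fun t => sin (2 * x * t) / (2 * x))).
    + intros t _. auto_derive; [exact I|]. field. exact Hx.
    + intros t _. apply (ex_derive_continuous (V := R_NormedModule)). auto_derive. exact I.
  - unfold minus, plus, opp; simpl. rewrite Rmult_0_r, sin_0.
    replace (2 * x * (PI / 2)) with (PI * x) by field. field. exact Hx.
Qed.

Lemma cos_int_0_0 : cos_int 0 0 = PI / 2.
Proof.
  unfold cos_int. rewrite (RInt_ext _ (fun _ => 1)).
  - rewrite RInt_const. unfold scal; simpl; unfold mult; simpl. ring.
  - intros t _. rewrite Rmult_0_r, Rmult_0_l, cos_0. simpl. ring.
Qed.

Lemma cos_int_even_pos (m : nat) : 0 < cos_int (2 * m) 0.
Proof.
  induction m as [|m IH].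
  - change (2 * 0)%nat with O. rewrite cos_int_0_0. generalize PI_RGT_0. lra.
  - replace (2 * S m)%nat with (2 * m + 2)%nat by lia.
    generalize (cos_int_rec (2 * m) 0). rewrite pow_i, Rmult_0_r, Rminus_0_r by lia.
    intros E. apply Rmult_lt_reg_l with (INR (2 * m + 2) ^ 2).
    + apply pow_lt, lt_0_INR. lia.
    + rewrite Rmult_0_r, E. apply Rmult_lt_0_compat; [|exact IH].
      apply Rmult_lt_0_compat; apply lt_0_INR; lia.
Qed.

(** The cubic Taylor bound together with t <= 2 gives even t / 3; the constant only affects the 32
    in [cos_int_close]. *)
Lemma quarter_le_sin (t : R) : 0 <= t -> t <= PI / 2 -> t / 4 <= sin t.
Proof.
  intros H0 H1. generalize PI_4. intros H4.
  destruct (sin_bound t 0 H0 ltac:(lra)) as [H _].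
  assert (E : t - t * t * t / 6 <= sin t).
  { eapply Rle_trans; [right|exact H]. unfold sin_approx, sin_term. simpl. field. }
  assert (t * t <= 4) by nra. nra.
Qed.

Lemma sin_sq_le (y : R) : sin y * sin y <= y * y.
Proof.
  assert (G : forall y, 0 <= y -> sin y * sin y <= y * y).
  { clear y. intros y [Hy|<-]; [|rewrite sin_0; lra].
    assert (Rabs (sin y) <= y).
    { apply Rabs_le. split; [|now apply Rlt_le, sin_lt_x].
      destruct (Rle_dec y PI) as [H|H].
      - generalize (sin_ge_0 y ltac:(lra) H). lra.
      - generalize (SIN_bound y) PI2_1. lra. }
    apply Rsqr_le_abs_1. rewrite (Rabs_pos_eq y) by lra. exact H. }
  destruct (Rle_dec 0 y) as [H|H]; [now apply G|].
  generalize (G (- y) ltac:(lra)). rewrite sin_neg. lra.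
Qed.

(** As m grows, cos^(2m) concentrates at 0, where the extra cosine is 1. Quantitatively, 1 - cos (2
    x t) = 2 sin^2 (x t) <= 2 x^2 t^2 <= 32 x^2 sin^2 t by t <= 4 sin t, and by the recursion the
    integral of sin^2 t cos^(2m) t is the fraction 1 / (2 (m + 1)) of that of cos^(2m) t. *)
Lemma cos_int_close (m : nat) (x : R) :
  Rabs (cos_int (2 * m) x / cos_int (2 * m) 0 - 1) <= 32 * x ^ 2 * / INR (S m).
Proof.
  set (J := cos_int (2 * m) 0).
  assert (HJ : 0 < J) by apply cos_int_even_pos.
  assert (HP : 0 < PI / 2) by (generalize PI_RGT_0; lra).
  assert (Hc : forall t, 0 < t < PI / 2 -> 0 <= cos t ^ (2 * m)).
  { intros t Ht. apply pow_le, Rlt_le, cos_gt_0; lra. }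
  assert (HU : cos_int (2 * m) x <= J).
  { apply RInt_le; try apply ex_RInt_cos_int; [lra|].
    intros t Ht. apply Rmult_le_compat_r; [now apply Hc|].
    rewrite Rmult_0_r, Rmult_0_l, cos_0. apply COS_bound. }
  assert (HL : J - 32 * x ^ 2 * (J - cos_int (2 * m + 2) 0) <= cos_int (2 * m) x).
  { set (g := fun t => cos (2 * 0 * t) * cos t ^ (2 * m)).
    set (g2 := fun t => cos (2 * 0 * t) * cos t ^ (2 * m + 2)).
    assert (E1 : ex_RInt g 0 (PI / 2)) by apply ex_RInt_cos_int.
    assert (E2 : ex_RInt g2 0 (PI / 2)) by apply ex_RInt_cos_int.
    generalize (is_RInt_comb (1 - 32 * x ^ 2) (- (32 * x ^ 2)) _ _ _ _ E1 E2). intros E3.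
    apply Rle_trans with (RInt (fun t => (1 - 32 * x ^ 2) * g t - - (32 * x ^ 2) * g2 t) 0 (PI / 2)).
    - right. rewrite (is_RInt_unique (V := R_CompleteNormedModule) _ _ _ _ E3).
      change (RInt g 0 (PI / 2)) with J. change (RInt g2 0 (PI / 2)) with (cos_int (2 * m + 2) 0).
      ring.
    - apply RInt_le; [lra| |apply ex_RInt_cos_int|].
      + eexists. exact E3.
      + intros t Ht. unfold g, g2. rewrite Rmult_0_r, Rmult_0_l, cos_0, pow_add.
        specialize (Hc t Ht). revert Hc.
        generalize (cos t ^ (2 * m)). intros c Hc.
        assert (K : 1 - 32 * x ^ 2 * (1 - cos t ^ 2) <= cos (2 * x * t)).
        { replace (2 * x * t) with (2 * (x * t)) by ring. rewrite cos_2a_sin.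
          generalize (sin_sq_le (x * t)) (quarter_le_sin t ltac:(lra) ltac:(lra)). intros S1 S2.
          assert (S3 : t * t <= 16 * (sin t * sin t)) by nra.
          generalize (sin2_cos2 t). unfold Rsqr. intros S4.
          replace (1 - cos t ^ 2) with (sin t * sin t) by (simpl; lra).
          apply (Rmult_le_compat_l (x * x)) in S3; [|apply Rle_0_sqr].
          simpl. lra. }
        apply (Rmult_le_compat_r c) in K; [|exact Hc]. lra. }
  generalize (cos_int_rec (2 * m) 0). fold J. rewrite pow_i, Rmult_0_r, Rminus_0_r by lia.
  replace (2 * m + 2)%nat with (2 * S m)%nat in * by lia.
  intros ER.
  assert (Hm : 0 < INR (S m)) by (apply lt_0_INR; lia).
  assert (EJ : J - cos_int (2 * S m) 0 = J * / (2 * INR (S m))).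
  { replace (cos_int (2 * S m) 0) with (INR (2 * m + 1) / INR (2 * S m) * J).
    - assert (N1 : INR (2 * S m) = 2 * INR (S m)) by (rewrite mult_INR; reflexivity).
      assert (N2 : INR (2 * m + 1) = 2 * INR (S m) - 1).
      { rewrite plus_INR, mult_INR, (S_INR m). simpl. ring. }
      rewrite N1, N2. field. lra.
    - apply Rmult_eq_reg_l with (INR (2 * S m) ^ 2).
      + rewrite ER. field. apply not_0_INR. lia.
      + apply pow_nonzero, not_0_INR. lia. }
  rewrite EJ in HL.
  assert (EQ : cos_int (2 * m) x / J - 1 = - ((J - cos_int (2 * m) x) / J)) by (field; lra).
  rewrite EQ.
  rewrite Rabs_Ropp, Rabs_pos_eq.
  - apply Rmult_le_reg_r with J; [exact HJ|].
    unfold Rdiv. rewrite Rmult_assoc, Rinv_l, Rmult_1_r by lra.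
    assert (Q : 32 * x ^ 2 * (J * / (2 * INR (S m))) <= 32 * x ^ 2 * / INR (S m) * J).
    { rewrite Rinv_mult. assert (0 <= 32 * x ^ 2 * (J * / INR (S m))); [|lra].
      apply Rmult_le_pos; [generalize (pow2_ge_0 x); lra|].
      apply Rmult_le_pos; [lra|]. now apply Rlt_le, Rinv_0_lt_compat. }
    lra.
  - apply Rdiv_le_0_compat; lra.
Qed.

(* The ratio [cos_int (2 * m) x / cos_int (2 * m) 0] tends to 1, while by [cos_int_rec] it is
   sin (pi x) / (pi x) divided by the m-th partial product of Euler's product for the sine. *)
Lemma Gamma_reflection (x : R) : nonint x ->
  Gamma x * Gamma (- x) = - PI / (x * sin (PI * x)).
Proof.
  intros Hx.
  assert (H0 : x <> 0) by (intros ->; now apply (Hx 0%Z)).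
  assert (Hp : forall j, x + INR j <> 0).
  { intros j. rewrite INR_IZR_INZ. now apply nonint_shift. }
  assert (Hm : forall j, - x + INR j <> 0).
  { intros j. rewrite INR_IZR_INZ. now apply nonint_shift, nonint_opp. }
  set (r := fun m => cos_int (2 * m) x / cos_int (2 * m) 0).
  assert (Hr : forall n, r n
    = r O * (- x ^ 2) * (INR (fact n) ^ 2 / (gauss_prod x n * gauss_prod (- x) n))).
  { induction n as [|n IH].
    - simpl. field. exact H0.
    - change (gauss_prod x (S n)) with (gauss_prod x n * (x + INR (S n))).
      change (gauss_prod (- x) (S n)) with (gauss_prod (- x) n * (- x + INR (S n))).
      rewrite INR_fact_S.
      generalize (gauss_prod_neq_0 x n Hp) (gauss_prod_neq_0 (- x) n Hm) (Hp (S n)) (Hm (S n)).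
      intros G1 G2 G3 G4.
      transitivity (r n * (INR (S n) ^ 2 / ((x + INR (S n)) * (- x + INR (S n)))));
        [|rewrite IH; field; auto].
      unfold r. generalize (cos_int_rec (2 * n) x) (cos_int_rec (2 * n) 0).
      rewrite pow_i, Rmult_0_r, Rminus_0_r by lia.
      generalize (cos_int_even_pos n) (cos_int_even_pos (S n)).
      replace (2 * n + 2)%nat with (2 * S n)%nat by lia.
      intros P1 P2 E1 E2.
      assert (N1 : INR (2 * S n) = 2 * INR (S n)) by (rewrite mult_INR; reflexivity).
      assert (N2 : INR (S n) <> 0) by (apply not_0_INR; lia).
      rewrite N1 in E1, E2.
      assert (N3 : INR (2 * n + 1) <> 0) by (apply not_0_INR; lia).
      replace (cos_int (2 * n) x) with
        (((2 * INR (S n)) ^ 2 - 4 * x ^ 2) * cos_int (2 * S n) x / (2 * INR (S n) * INR (2 * n + 1)))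
        by (rewrite E1; field; auto).
      replace (cos_int (2 * n) 0) with
        ((2 * INR (S n)) ^ 2 * cos_int (2 * S n) 0 / (2 * INR (S n) * INR (2 * n + 1)))
        by (rewrite E2; field; auto).
      field. repeat split; auto. lra. }
  assert (L1 : is_lim_seq r 1).
  { apply (is_lim_seq_ext (fun m => (r m - 1) + 1)); [intros; ring|].
    replace (Finite 1) with (Finite (0 + 1)) by (f_equal; ring).
    apply is_lim_seq_plus'; [|apply is_lim_seq_const].
    apply is_lim_seq_abs_0.
    apply (is_lim_seq_le_le (fun _ => 0) _ (fun m => 32 * x ^ 2 * / INR (S m))).
    - intros m. split; [apply Rabs_pos|exact (cos_int_close m x)].
    - apply is_lim_seq_const.
    - replace (Finite 0) with (Finite (32 * x ^ 2 * 0)) by (f_equal; ring).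
      apply is_lim_seq_mult'; [apply is_lim_seq_const|]. exact is_lim_seq_inv_INR_S. }
  assert (L2 : is_lim_seq r (r O * (- x ^ 2) * (Gamma x * Gamma (- x)))).
  { apply (is_lim_seq_ext (fun n => r O * (- x ^ 2) * (gauss_seq x n * gauss_seq (- x) n))).
    - intros n. rewrite (Hr n). f_equal. unfold gauss_seq.
      transitivity (INR (fact n) ^ 2 * Rpower (INR n) (x + - x)
                    / (gauss_prod x n * gauss_prod (- x) n)).
      + rewrite Rpower_plus. field. split; now apply gauss_prod_neq_0.
      + rewrite Rplus_opp_r. unfold Rpower. rewrite Rmult_0_l, exp_0, Rmult_1_r. reflexivity.
    - apply is_lim_seq_mult'; [apply is_lim_seq_const|].
      apply is_lim_seq_mult'; apply is_lim_gauss_seq. }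
  apply is_lim_seq_unique in L1. apply is_lim_seq_unique in L2.
  rewrite L1 in L2. injection L2 as L. revert L. unfold r. change (2 * 0)%nat with O.
  rewrite cos_int_0_l, cos_int_0_0 by exact H0. generalize PI_neq0. intros HPI L.
  (* A zero of the sine would make the limit 0 instead of 1. *)
  assert (Hs : sin (PI * x) <> 0).
  { intros E. rewrite E in L. unfold Rdiv in L. rewrite !Rmult_0_l in L. lra. }
  replace (- PI / (x * sin (PI * x))) with (- PI / (x * sin (PI * x)) * 1) by ring.
  rewrite L. field. repeat split; assumption.
Qed.

Lemma sin_PI_neq_0 (x : R) : nonint x -> sin (PI * x) <> 0.
Proof.
  intros Hx E. apply sin_eq_0_0 in E. destruct E as [k E].
  apply (Hx k). apply Rmult_eq_reg_l with PI; [lra|apply PI_neq0].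
Qed.

(** * Pochhammer symbols and the digamma function *)

Lemma Gamma_add (a : R) (n : nat) : (forall j, a + INR j <> 0) ->
  Gamma (a + INR n) = rising a n * Gamma a.
Proof.
  intros H. induction n as [|n IH]; [simpl; rewrite Rplus_0_r; ring|].
  rewrite S_INR, <- Rplus_assoc, Gamma_succ, IH by apply H. simpl. ring.
Qed.

Lemma poch_rising (a : R) (n : nat) : (forall j, a + INR j <> 0) -> poch a n = rising a n.
Proof.
  intros H. unfold poch. rewrite Gamma_add by exact H. field. now apply Gamma_neq_0.
Qed.

(** A single [d] serves all integers and a whole neighbourhood of [x], which later gives majorants
    uniform in the order. *)
Lemma nonint_dist (x : R) : nonint x ->
  exists d : posreal, forall y, Rabs (y - x) < d -> forall m, d <= Rabs (y - IZR m).
Proof.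
  intros H. destruct (archimed x) as [A1 A2].
  set (k := up x) in *.
  assert (B : 0 < x - IZR (k - 1)).
  { generalize (H (k - 1)%Z). rewrite minus_IZR. lra. }
  (* Half the distance to the nearest integer: a point moved by less than this keeps at least the
     other half. *)
  assert (Hd : 0 < Rmin (IZR k - x) (x - IZR (k - 1)) / 2).
  { apply Rdiv_lt_0_compat; [|lra]. apply Rmin_pos; lra. }
  exists (mkposreal _ Hd). simpl. intros y Hy m. apply Rabs_def2 in Hy.
  generalize (Rmin_l (IZR k - x) (x - IZR (k - 1))) (Rmin_r (IZR k - x) (x - IZR (k - 1))).
  intros M1 M2.
  destruct (Z_le_gt_dec k m) as [Hm|Hm].
  - apply IZR_le in Hm. rewrite Rabs_left1; lra.
  - assert (Hm' : (m <= k - 1)%Z) by lia. apply IZR_le in Hm'. rewrite Rabs_pos_eq; lra.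
Qed.

Lemma locally_nonint (x : R) : nonint x -> locally x nonint.
Proof.
  intros H. destruct (nonint_dist x H) as [d Hd]. exists d. intros y Hy m E.
  generalize (Hd y Hy m). rewrite E, Rminus_diag, Rabs_R0. generalize (cond_pos d). lra.
Qed.

Lemma digamma_opp (x : R) : nonint x ->
  digamma (- x) = digamma x + 1 / x + PI * (cos (PI * x) / sin (PI * x)).
Proof.
  intros H.
  assert (Hp : forall j, x + INR j <> 0).
  { intros j. rewrite INR_IZR_INZ. now apply nonint_shift. }
  assert (Hm : forall j, - x + INR j <> 0).
  { intros j. rewrite INR_IZR_INZ. now apply nonint_shift, nonint_opp. }
  generalize (Gamma_neq_0 x Hp) (Gamma_neq_0 (- x) Hm). intros G1 G2.
  generalize (ex_derive_Gamma x Hp) (ex_derive_Gamma (- x) Hm). intros D1 D2.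
  assert (x0 : x <> 0) by (generalize (Hp O); simpl; now rewrite Rplus_0_r).
  generalize (sin_PI_neq_0 x H). intros Hs.
  generalize (Gamma_reflection x H). intros HR.
  assert (E : Derive (fun y => Gamma y * Gamma (- y)) x
              = Derive (fun y => - PI / (y * sin (PI * y))) x).
  { apply Derive_ext_loc. generalize (locally_nonint x H). apply filter_imp.
    intros y Hy. now apply Gamma_reflection. }
  assert (E1 : Derive (fun y => Gamma y * Gamma (- y)) x
               = Derive Gamma x * Gamma (- x) - Gamma x * Derive Gamma (- x)).
  { apply is_derive_unique. auto_derive; [repeat split; assumption|].
    change (fun y : R => Gamma y) with Gamma. ring. }
  assert (E2 : Derive (fun y => - PI / (y * sin (PI * y))) x
    = - PI / (x * sin (PI * x)) * (- (1 / x) - PI * (cos (PI * x) / sin (PI * x)))).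
  { apply is_derive_unique. auto_derive.
    - now apply Rmult_integral_contrapositive_currified.
    - field. now split. }
  rewrite E1, E2, <- HR in E. unfold digamma.
  apply Rmult_eq_reg_l with (Gamma x * Gamma (- x)).
  - transitivity (Gamma x * Derive Gamma (- x)); [field; exact G2|].
    replace (Gamma x * Derive Gamma (- x)) with
      (Derive Gamma x * Gamma (- x) - Gamma x * Gamma (- x) *
         (- (1 / x) - PI * (cos (PI * x) / sin (PI * x)))) by lra.
    field. repeat split; assumption.
  - now apply Rmult_integral_contrapositive_currified.
Qed.

(** * Entire power series with real coefficients *)

(** Absolute convergence at every real radius. Since the coefficients are real, it controls the real
    and imaginary parts of [psum] at once, through |Re (x^n)|, |Im (x^n)| <= |x|^n. *)
Definition entire (a : nat -> R) : Prop :=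
  forall r, 0 <= r -> ex_series (fun n => Rabs (a n) * r ^ n).

Definition psum (a : nat -> R) (x : C) : C := CSeries (fun k => RtoC (a k) * x ^ k)%C.

Lemma Re_Cmult (u v : C) : Re (u * v)%C = Re u * Re v - Im u * Im v.
Proof. reflexivity. Qed.

Lemma Im_Cmult (u v : C) : Im (u * v)%C = Re u * Im v + Im u * Re v.
Proof. reflexivity. Qed.

Lemma Re_RtoC_mult (c : R) (w : C) : Re (RtoC c * w)%C = c * Re w.
Proof. destruct w. simpl. ring. Qed.

Lemma Im_RtoC_mult (c : R) (w : C) : Im (RtoC c * w)%C = c * Im w.
Proof. destruct w. simpl. ring. Qed.

Lemma Re_psum (a : nat -> R) (x : C) : Re (psum a x) = Series (fun k => a k * Re (x ^ k)%C).
Proof. apply Series_ext. intros n. apply Re_RtoC_mult. Qed.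

Lemma Im_psum (a : nat -> R) (x : C) : Im (psum a x) = Series (fun k => a k * Im (x ^ k)%C).
Proof. apply Series_ext. intros n. apply Im_RtoC_mult. Qed.

Lemma C_ext (u v : C) : Re u = Re v -> Im u = Im v -> u = v.
Proof. destruct u, v. simpl. now intros -> ->. Qed.

Lemma Rabs_Re_pow (x : C) (n : nat) : Rabs (Re (x ^ n)%C) <= Cmod x ^ n.
Proof.
  rewrite <- Cmod_pow. eapply Rle_trans; [|apply Rmax_Cmod]. apply Rmax_l.
Qed.

Lemma Rabs_Im_pow (x : C) (n : nat) : Rabs (Im (x ^ n)%C) <= Cmod x ^ n.
Proof.
  rewrite <- Cmod_pow. eapply Rle_trans; [|apply Rmax_Cmod]. apply Rmax_r.
Qed.

Lemma entire_le (a b : nat -> R) : (forall n, Rabs (a n) <= b n) -> entire b -> entire a.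
Proof.
  intros H Hb r Hr. apply (ex_series_Rle _ (fun n => Rabs (b n) * r ^ n)); [|now apply Hb].
  intros n. rewrite Rabs_mult, Rabs_Rabsolu, (Rabs_pos_eq (r ^ n)) by now apply pow_le.
  apply Rmult_le_compat_r; [now apply pow_le|].
  eapply Rle_trans; [apply H|apply Rle_abs].
Qed.

Lemma entire_Rabs (a : nat -> R) : entire a -> entire (fun n => Rabs (a n)).
Proof.
  intros Ha r Hr. apply (ex_series_ext (fun n => Rabs (a n) * r ^ n)); [|now apply Ha].
  intros n. now rewrite Rabs_Rabsolu.
Qed.

Lemma entire_scal (c : R) (a : nat -> R) : entire a -> entire (fun n => c * a n).
Proof.
  intros Ha r Hr.
  apply (ex_series_ext (fun n => Rabs c * (Rabs (a n) * r ^ n))).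
  - intros n. now rewrite Rabs_mult, Rmult_assoc.
  - now apply ex_series_Rscal, Ha.
Qed.

Lemma entire_minus (a b : nat -> R) : entire a -> entire b -> entire (a - b)%ps.
Proof.
  intros Ha Hb r Hr.
  apply (ex_series_Rle _ (fun n => Rabs (a n) * r ^ n + Rabs (b n) * r ^ n)).
  - intros n. rewrite Rabs_mult, Rabs_Rabsolu, (Rabs_pos_eq (r ^ n)) by now apply pow_le.
    rewrite <- Rmult_plus_distr_r. apply Rmult_le_compat_r; [now apply pow_le|].
    unfold psub, Rminus. rewrite <- (Rabs_Ropp (b n)). apply Rabs_triang.
  - apply (ex_series_plus (K := R_AbsRing) (V := R_NormedModule)); [now apply Ha|now apply Hb].
Qed.

Lemma entire_const (c : R) : entire (pconst c).
Proof.
  intros r Hr. apply (proj2 (ex_series_incr_1 (K := R_AbsRing) (V := R_NormedModule) _)).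
  apply (ex_series_ext (fun n => 0 * / INR (S n) ^ 2)).
  - intros n. simpl pconst. rewrite Rabs_R0, !Rmult_0_l. reflexivity.
  - apply ex_series_Rscal, ex_series_inv_sq.
Qed.

Lemma pmul_sum (a b : nat -> R) (n : nat) :
  (a * b)%ps n = sum_f_R0 (fun k => a k * b (n - k)%nat) n.
Proof.
  revert a. induction n as [|n IH]; intros a; [reflexivity|].
  rewrite decomp_sum by lia. simpl. f_equal. apply IH.
Qed.

Lemma Rabs_pmul_le (a b a' b' : nat -> R) (n : nat) :
  (forall k, Rabs (a k) <= a' k) -> (forall k, Rabs (b k) <= b' k) ->
  Rabs ((a * b)%ps n) <= (a' * b')%ps n.
Proof.
  intros Ha Hb. rewrite !pmul_sum. eapply Rle_trans; [apply Rsum_abs|].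
  apply sum_Rle. intros k _. rewrite Rabs_mult.
  apply Rmult_le_compat; try apply Rabs_pos; auto.
Qed.

Lemma pmul_pow (a b : nat -> R) (r : R) (n : nat) :
  pmul (fun k => a k * r ^ k) (fun k => b k * r ^ k) n = (a * b)%ps n * r ^ n.
Proof.
  rewrite !pmul_sum, Rmult_comm, scal_sum. apply sum_eq. intros k Hk.
  replace (r ^ n) with (r ^ k * r ^ (n - k)) by (rewrite <- pow_add; f_equal; lia). ring.
Qed.

Lemma entire_mul (a b : nat -> R) : entire a -> entire b -> entire (a * b)%ps.
Proof.
  intros Ha Hb. apply (entire_le _ ((fun n => Rabs (a n)) * (fun n => Rabs (b n)))%ps).
  { intros n. apply Rabs_pmul_le; intros; apply Rle_refl. }
  intros r Hr.
  assert (Ea : ex_series (fun n => Rabs (a n) * r ^ n)) by now apply Ha.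
  assert (Eb : ex_series (fun n => Rabs (b n) * r ^ n)) by now apply Hb.
  assert (G : forall c : nat -> R, ex_series (fun n => Rabs (c n) * r ^ n) ->
    ex_series (fun n => Rabs (Rabs (c n) * r ^ n))).
  { intros c Hc. apply (ex_series_ext _ _ (fun n => eq_sym (Rabs_pos_eq _
      (Rmult_le_pos _ _ (Rabs_pos (c n)) (pow_le r n Hr))))). exact Hc. }
  generalize (is_series_mult _ _ _ _ (Series_correct _ Ea) (Series_correct _ Eb) (G a Ea) (G b Eb)).
  intros E. eexists. eapply is_series_ext; [|exact E]. intros n. cbv beta.
  rewrite <- (pmul_sum (fun n => Rabs (a n) * r ^ n) (fun n => Rabs (b n) * r ^ n)), pmul_pow.
  f_equal. symmetry. apply Rabs_pos_eq. rewrite pmul_sum.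
  apply cond_pos_sum. intros k. apply Rmult_le_pos; apply Rabs_pos.
Qed.

Lemma ex_series_psum_abs (a c : nat -> R) (x : C) :
  (forall n, Rabs (c n) <= Cmod x ^ n) -> entire a ->
  ex_series (fun n => Rabs (a n * c n)).
Proof.
  intros Hc Ha. apply (ex_series_Rle _ (fun n => Rabs (a n) * Cmod x ^ n)).
  - intros n. rewrite Rabs_Rabsolu, Rabs_mult.
    apply Rmult_le_compat_l; [apply Rabs_pos|apply Hc].
  - apply Ha, Cmod_ge_0.
Qed.

Lemma psum_minus (a b : nat -> R) (x : C) : entire a -> entire b ->
  psum (a - b)%ps x = (psum a x - psum b x)%C.
Proof.
  intros Ha Hb.
  assert (G : forall c, (forall n, Rabs (c n) <= Cmod x ^ n) ->
    Series (fun n => (a - b)%ps n * c n) = Series (fun n => a n * c n) - Series (fun n => b n * c n)).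
  { intros c Hc. rewrite <- Series_minus;
      try (now apply ex_series_Rabs, (ex_series_psum_abs _ _ x)).
    apply Series_ext. intros n. unfold psub. ring. }
  apply C_ext.
  - change (Re (psum (a - b)%ps x) = Re (psum a x) - Re (psum b x)).
    rewrite !Re_psum. apply G, Rabs_Re_pow.
  - change (Im (psum (a - b)%ps x) = Im (psum a x) - Im (psum b x)).
    rewrite !Im_psum. apply G, Rabs_Im_pow.
Qed.

Lemma psum_scal (c : R) (a : nat -> R) (x : C) :
  psum (pconst c * a)%ps x = (RtoC c * psum a x)%C.
Proof.
  apply C_ext.
  - rewrite Re_RtoC_mult, !Re_psum, <- Series_scal_l. apply Series_ext. intros n. rewrite pmul_const. ring.
  - rewrite Im_RtoC_mult, !Im_psum, <- Series_scal_l. apply Series_ext. intros n. rewrite pmul_const. ring.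
Qed.

(** [CSeries] is a pair of real series, so the real Cauchy product theorem is applied to the four
    pairings of real and imaginary parts, recombined by x^n = x^k x^(n-k). *)
Lemma psum_mul (a b : nat -> R) (x : C) : entire a -> entire b ->
  psum (a * b)%ps x = (psum a x * psum b x)%C.
Proof.
  intros Ha Hb.
  assert (G : forall c d, (forall n, Rabs (c n) <= Cmod x ^ n) ->
    (forall n, Rabs (d n) <= Cmod x ^ n) ->
    is_series (pmul (fun n => a n * c n) (fun n => b n * d n))
      (Series (fun n => a n * c n) * Series (fun n => b n * d n))).
  { intros c d Hc Hd.
    eapply is_series_ext; [intros n; symmetry; apply pmul_sum|].
    apply is_series_mult; try (apply Series_correct, ex_series_Rabs);
      now apply (ex_series_psum_abs _ _ x). }
  assert (Hpow : forall n k, (k <= n)%nat -> (x ^ n = x ^ k * x ^ (n - k))%C).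
  { intros n k Hk. rewrite <- Cpow_add_r. f_equal. lia. }
  assert (GR := Rabs_Re_pow x). assert (GI := Rabs_Im_pow x).
  apply C_ext.
  - change (Re (psum (a * b)%ps x) = Re (psum a x) * Re (psum b x) - Im (psum a x) * Im (psum b x)).
    rewrite !Re_psum, !Im_psum. apply is_series_unique.
    eapply is_series_ext;
      [|exact (is_series_minus _ _ _ _ (G _ _ GR GR) (G _ _ GI GI))].
    intros n.
    change (pmul (fun k => a k * Re (x ^ k)%C) (fun k => b k * Re (x ^ k)%C) n
            - pmul (fun k => a k * Im (x ^ k)%C) (fun k => b k * Im (x ^ k)%C) n
            = pmul a b n * Re (x ^ n)%C).
    rewrite !pmul_sum, Rmult_comm, scal_sum, <- minus_sum. apply sum_eq. intros k Hk.
    rewrite (Hpow n k Hk), Re_Cmult. ring.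
  - change (Im (psum (a * b)%ps x) = Re (psum a x) * Im (psum b x) + Im (psum a x) * Re (psum b x)).
    rewrite !Re_psum, !Im_psum. apply is_series_unique.
    eapply is_series_ext;
      [|exact (is_series_plus _ _ _ _ (G _ _ GR GI) (G _ _ GI GR))].
    intros n.
    change (pmul (fun k => a k * Re (x ^ k)%C) (fun k => b k * Im (x ^ k)%C) n
            + pmul (fun k => a k * Im (x ^ k)%C) (fun k => b k * Re (x ^ k)%C) n
            = pmul a b n * Im (x ^ n)%C).
    rewrite !pmul_sum, Rmult_comm, scal_sum, <- sum_plus. apply sum_eq. intros k Hk.
    rewrite (Hpow n k Hk), Im_Cmult. ring.
Qed.

Lemma entire_shift (a : nat -> R) : entire a -> entire (pshift a).
Proof.
  intros Ha r Hr.
  (* The radius [r + 1] avoids a division by [r], which may be 0, and is at least 1, so that raising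
     the exponent enlarges the bound. *)
  apply (ex_series_Rle _ (fun n => Rabs (a (S n)) * (r + 1) ^ S n)).
  - intros n. rewrite Rabs_mult, Rabs_Rabsolu, (Rabs_pos_eq (r ^ n)) by now apply pow_le.
    apply Rmult_le_compat_l; [apply Rabs_pos|].
    eapply Rle_trans; [apply pow_incr with (y := r + 1); lra|].
    apply Rle_pow; [lra|lia].
  - apply (proj1 (ex_series_incr_1 (K := R_AbsRing) (V := R_NormedModule)
      (fun n => Rabs (a n) * (r + 1) ^ n))). apply Ha. lra.
Qed.

Lemma psum_shift (a : nat -> R) (x : C) : entire a ->
  psum a x = (RtoC (a O) + x * psum (pshift a) x)%C.
Proof.
  intros Ha. assert (Hs := entire_shift a Ha).
  assert (E : forall c, (forall n, Rabs (c n) <= Cmod x ^ n) -> ex_series (fun n => a n * c n)).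
  { intros c Hc. now apply ex_series_Rabs, (ex_series_psum_abs _ _ x). }
  assert (E1 : forall c k, (forall n, Rabs (c n) <= Cmod x ^ n) ->
              ex_series (fun n => k * (pshift a n * c n))).
  { intros c k Hc. now apply ex_series_Rscal, ex_series_Rabs, (ex_series_psum_abs _ _ x). }
  apply C_ext.
  - change (Re (psum a x) = a O + (Re x * Re (psum (pshift a) x) - Im x * Im (psum (pshift a) x))).
    rewrite !Re_psum, Im_psum, Series_incr_1 by (apply E, Rabs_Re_pow).
    f_equal; [simpl; ring|].
    rewrite <- !Series_scal_l, <- Series_minus by
      (apply E1; first [apply Rabs_Re_pow | apply Rabs_Im_pow]).
    apply Series_ext. intros n. rewrite Cpow_S, Re_Cmult. unfold pshift. ring.
  - change (Im (psum a x) = 0 + (Re x * Im (psum (pshift a) x) + Im x * Re (psum (pshift a) x))).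
    rewrite !Im_psum, Re_psum, Series_incr_1 by (apply E, Rabs_Im_pow).
    f_equal; [simpl; ring|].
    rewrite <- !Series_scal_l, <- Series_plus by
      (apply E1; first [apply Rabs_Re_pow | apply Rabs_Im_pow]).
    apply Series_ext. intros n. rewrite Cpow_S, Im_Cmult. unfold pshift. ring.
Qed.

Lemma psum_const (c : R) (x : C) : psum (pconst c) x = RtoC c.
Proof.
  rewrite psum_shift by apply entire_const.
  replace (pshift (pconst c)) with (pconst 0 * pconst 0)%ps.
  - rewrite psum_scal. simpl. ring.
  - rewrite <- pconst_mul. apply functional_extensionality. intros [|n]; unfold pshift, pconst; ring.
Qed.

Lemma entire_exp (q : R) : 0 <= q -> entire (fun n => q ^ n / INR (fact n)).
Proof.
  intros Hq r Hr.
  assert (E : forall n, / INR (fact n) * (q * r) ^ n = Rabs (q ^ n / INR (fact n)) * r ^ n).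
  { intros n. rewrite Rabs_pos_eq.
    - rewrite Rpow_mult_distr. unfold Rdiv. ring.
    - apply Rdiv_le_0_compat; [now apply pow_le|apply INR_fact_lt_0]. }
  apply (ex_series_ext _ _ E). apply ex_pseries_R. exists (exp (q * r)). apply is_exp_Reals.
Qed.

Lemma INR_le_pow2 (n : nat) : INR n <= 2 ^ n.
Proof.
  induction n as [|n IH]; [simpl; lra|]. rewrite S_INR. simpl.
  generalize (pow_R1_Rle 2 n ltac:(lra)). lra.
Qed.

(** * Bounds for the reduced Bessel series near a non-integer order *)

Lemma Rabs_rising_ge (a d : R) (n : nat) :
  0 <= d -> (forall j, d <= Rabs (a + INR j)) -> d ^ n <= Rabs (rising a n).
Proof.
  intros Hd H. induction n as [|n IH]; simpl.
  - rewrite Rabs_R1. lra.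
  - rewrite Rabs_mult, Rmult_comm. apply Rmult_le_compat; auto. now apply pow_le.
Qed.

(** Each factor of the rising factorial is bounded below by [d], not better; the remaining factorial
    suffices for an entire series. *)
Definition bes_majorant (d : R) (n : nat) : R := (/ d) ^ n / INR (fact n).

Lemma Rabs_bes_le (nu d : R) (n : nat) :
  0 < d -> (forall j, d <= Rabs (nu + 1 + INR j)) -> Rabs (bes nu n) <= bes_majorant d n.
Proof.
  intros Hd H. unfold bes, bes_majorant.
  rewrite Rabs_div, pow_1_abs, Rabs_mult, (Rabs_pos_eq (INR (fact n)))
    by (apply Rlt_le, INR_fact_lt_0 || (apply Rmult_integral_contrapositive_currified;
       [apply INR_fact_neq_0|apply rising_neq_0; intros j E; specialize (H j);
        rewrite E, Rabs_R0 in H; lra])).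
  generalize (Rabs_rising_ge (nu + 1) d n (Rlt_le _ _ Hd) H) (INR_fact_lt_0 n) (pow_lt d n Hd).
  intros H1 H2 H3. rewrite pow_inv. unfold Rdiv. rewrite Rmult_1_l, Rinv_mult, Rmult_comm.
  apply Rmult_le_compat_r; [now apply Rlt_le, Rinv_0_lt_compat|].
  now apply Rinv_le_contravar.
Qed.

Lemma Rabs_harm_le (a d : R) (n : nat) :
  0 < d -> (forall j, d <= Rabs (a + INR j)) -> Rabs (harm a n) <= INR n * / d.
Proof.
  intros Hd H. induction n as [|n IH].
  - simpl. rewrite Rabs_R0. lra.
  - rewrite S_INR. simpl. eapply Rle_trans; [apply Rabs_triang|].
    rewrite Rmult_plus_distr_r, Rmult_1_l. apply Rplus_le_compat; [exact IH|].
    rewrite Rabs_inv. now apply Rinv_le_contravar.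
Qed.

(** The harmonic sum costs a factor n / d, and n <= 2^n keeps the bound of exponential type. *)
Definition dbes_majorant (d : R) (n : nat) : R := / d * ((2 / d) ^ n / INR (fact n)).

Lemma Rabs_dbes_le (nu d : R) (n : nat) :
  0 < d -> (forall j, d <= Rabs (nu + 1 + INR j)) -> Rabs (dbes nu n) <= dbes_majorant d n.
Proof.
  intros Hd H. unfold dbes, dbes_majorant. rewrite Rabs_mult, Rabs_Ropp.
  assert (Hd' : 0 < / d) by now apply Rinv_0_lt_compat.
  eapply Rle_trans.
  - apply Rmult_le_compat; try apply Rabs_pos;
      [apply (Rabs_bes_le nu d n Hd H)|apply (Rabs_harm_le (nu + 1) d n Hd H)].
  - unfold bes_majorant, Rdiv. rewrite Rpow_mult_distr.
    replace (/ d * (2 ^ n * (/ d) ^ n * / INR (fact n)))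
      with ((/ d) ^ n * / INR (fact n) * (2 ^ n * / d)) by ring.
    apply Rmult_le_compat_l.
    + apply Rmult_le_pos; [apply pow_le; lra|]. apply Rlt_le, Rinv_0_lt_compat, INR_fact_lt_0.
    + apply Rmult_le_compat_r; [lra|apply INR_le_pow2].
Qed.

Lemma entire_bes_majorant (d : R) : 0 < d -> entire (bes_majorant d).
Proof. intros H. apply entire_exp. now apply Rlt_le, Rinv_0_lt_compat. Qed.

Lemma entire_dbes_majorant (d : R) : 0 < d -> entire (dbes_majorant d).
Proof.
  intros H. apply (entire_scal (/ d)), entire_exp.
  apply Rdiv_le_0_compat; lra.
Qed.

Lemma nonint_dist_shift (nu : R) : nonint nu ->
  exists d : posreal, forall s, Rabs (s - nu) < d ->
    forall j : nat, d <= Rabs (s + INR j) /\ d <= Rabs (s + 1 + INR j).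
Proof.
  intros H. destruct (nonint_dist nu H) as [d Hd]. exists d. intros s Hs j. split.
  - generalize (Hd s Hs (- Z.of_nat j)%Z). rewrite opp_IZR, <- INR_IZR_INZ.
    now replace (s - - INR j) with (s + INR j) by ring.
  - generalize (Hd s Hs (- Z.of_nat (S j))%Z). rewrite opp_IZR, <- INR_IZR_INZ, S_INR.
    now replace (s - - (INR j + 1)) with (s + 1 + INR j) by ring.
Qed.

Lemma entire_bes (nu : R) : nonint nu -> entire (bes nu).
Proof.
  intros H. destruct (nonint_dist_shift nu H) as [d Hd].
  apply (entire_le _ (bes_majorant d)); [|apply entire_bes_majorant, cond_pos].
  intros n. apply Rabs_bes_le; [apply cond_pos|]. intros j. apply Hd.
  rewrite Rminus_diag, Rabs_R0. apply cond_pos.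
Qed.

Lemma Rabs_besA_le (nu d : R) (n : nat) :
  0 < d -> (forall j, d <= Rabs (nu + INR j) /\ d <= Rabs (nu + 1 + INR j)) ->
  Rabs (besA nu n) <= Rabs nu * / d * (bes_majorant d * bes_majorant d)%ps n.
Proof.
  intros Hd H. unfold besA, Rdiv. rewrite !Rabs_mult, Rabs_inv.
  rewrite Rmult_assoc, Rmult_assoc. apply Rmult_le_compat_l; [apply Rabs_pos|].
  rewrite Rmult_comm. apply Rmult_le_compat.
  - apply Rlt_le, Rinv_0_lt_compat. eapply Rlt_le_trans; [exact Hd|apply H].
  - apply Rabs_pos.
  - apply Rinv_le_contravar; [exact Hd|apply H].
  - apply Rabs_pmul_le; intros k; apply Rabs_bes_le; auto; apply H.
Qed.

Lemma entire_besA_majorant (c d : R) : 0 < d ->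
  entire (fun n => c * (bes_majorant d * bes_majorant d)%ps n).
Proof. intros H. now apply entire_scal, entire_mul; apply entire_bes_majorant. Qed.

Lemma entire_besA (nu : R) : nonint nu -> entire (besA nu).
Proof.
  intros H. destruct (nonint_dist_shift nu H) as [d Hd].
  apply (entire_le _ (fun n => Rabs nu * / d * (bes_majorant d * bes_majorant d)%ps n)).
  - intros n. apply Rabs_besA_le; [apply cond_pos|]. apply Hd.
    rewrite Rminus_diag, Rabs_R0. apply cond_pos.
  - apply entire_besA_majorant, cond_pos.
Qed.

Lemma entire_besG (nu : R) : nonint nu -> entire (besG nu).
Proof.
  intros H. apply (entire_le _ (fun n => Rabs ((bes nu * bes (- nu))%ps n))).
  - intros [|n].
    + simpl. rewrite Rabs_R0. apply Rabs_pos.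
    + unfold besG, Rdiv. rewrite Rabs_mult, Rabs_Ropp, <- (Rmult_1_r (Rabs _)) at 1.
      rewrite Rmult_1_r. rewrite <- (Rmult_1_r (Rabs ((bes nu * _)%ps _))) at 2.
      apply Rmult_le_compat_l; [apply Rabs_pos|].
      generalize (pos_INR n). rewrite S_INR. intros Hn.
      rewrite Rabs_inv, Rabs_pos_eq by lra. rewrite <- Rinv_1.
      apply Rinv_le_contravar; lra.
  - apply entire_Rabs, entire_mul; apply entire_bes; [exact H|now apply nonint_opp].
Qed.

Lemma psum_dbes (nu : R) (x : C) : nonint nu ->
  psum (dbes nu) x
  = (psum (bes nu) x * (RtoC (1 / (2 * nu)) - psum (besG nu) x)
     - RtoC (1 / (2 * nu)) * (psum (bes (- nu)) x * psum (besA nu) x))%C.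
Proof.
  intros H. rewrite (dbes_eq nu H).
  generalize (entire_bes nu H) (entire_bes _ (nonint_opp nu H)) (entire_besA nu H)
    (entire_besG nu H) (entire_const (1 / (2 * nu))).
  intros E1 E2 E3 E4 E5.
  rewrite psum_minus, psum_scal, !psum_mul, psum_minus, psum_const;
    auto using entire_mul, entire_minus.
Qed.

(** * Complex-valued functions of a real variable *)

(** Componentwise, so that the calculus is that of real functions; [is_Cderive_is_derive] converts
    the final result. *)
Definition is_Cderive (f : R -> C) (t : R) (l : C) : Prop :=
  is_derive (fun s => Re (f s)) t (Re l) /\ is_derive (fun s => Im (f s)) t (Im l).

Lemma is_Cderive_is_derive (f : R -> C) (t : R) (l : C) :
  is_Cderive f t l -> @is_derive R_AbsRing C_R_NormedModule f t l.
Proof.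
  intros [H1 H2].
  set (V := prod_NormedModule R_AbsRing R_NormedModule R_NormedModule).
  assert (H : is_derive (V := V) (fun s => (Re (f s), Im (f s))) t (Re l, Im l)).
  { apply (filterdiff_comp_2 (W := V) (fun s => Re (f s)) (fun s => Im (f s))
      (fun a b : R => (a, b)) (fun y => scal y (Re l)) (fun y => scal y (Im l))
      (fun a b : R => (a, b)) H1 H2).
    apply filterdiff_linear.
    apply (is_linear_prod (T := V) (U := R_NormedModule) (V := R_NormedModule)
      (fun t => fst t) (fun t => snd t)); [apply is_linear_fst|apply is_linear_snd]. }
  replace l with (Re l, Im l) by (now destruct l).
  apply (is_derive_ext (V := V) (fun s => (Re (f s), Im (f s)))); [|exact H].
  intros s. now destruct (f s).
Qed.

Lemma is_Cderive_ext_loc (f g : R -> C) (t : R) (l : C) :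
  locally t (fun s => f s = g s) -> is_Cderive f t l -> is_Cderive g t l.
Proof.
  intros H [H1 H2]. split.
  - apply (is_derive_ext_loc (fun s => Re (f s))); [|exact H1].
    revert H. apply filter_imp. now intros s ->.
  - apply (is_derive_ext_loc (fun s => Im (f s))); [|exact H2].
    revert H. apply filter_imp. now intros s ->.
Qed.

Lemma is_Cderive_RtoC (f : R -> R) (t l : R) :
  is_derive f t l -> is_Cderive (fun s => RtoC (f s)) t (RtoC l).
Proof. intros H. split; simpl; [exact H|]. apply (is_derive_const (V := R_NormedModule)). Qed.

Lemma is_Cderive_minus (f g : R -> C) (t : R) (l m : C) :
  is_Cderive f t l -> is_Cderive g t m -> is_Cderive (fun s => f s - g s)%C t (l - m)%C.
Proof.
  intros [H1 H2] [H3 H4].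
  split; apply (is_derive_minus (V := R_NormedModule)); assumption.
Qed.

Lemma is_Cderive_mult (f g : R -> C) (t : R) (l m : C) :
  is_Cderive f t l -> is_Cderive g t m ->
  is_Cderive (fun s => f s * g s)%C t (l * g t + f t * m)%C.
Proof.
  intros [H1 H2] [H3 H4].
  assert (M : forall (u v : R -> R) du dv, is_derive u t du -> is_derive v t dv ->
    is_derive (fun s => u s * v s) t (du * v t + u t * dv)).
  { intros u v du dv Hu Hv.
    apply (is_derive_mult (K := R_AbsRing) u v); auto. intros; apply Rmult_comm. }
  split.
  - replace (Re (l * g t + f t * m)%C) with
      ((Re l * Re (g t) + Re (f t) * Re m) - (Im l * Im (g t) + Im (f t) * Im m))
      by (simpl; unfold Re, Im; ring).
    apply (is_derive_minus (V := R_NormedModule) (fun s => Re (f s) * Re (g s))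
             (fun s => Im (f s) * Im (g s))); now apply M.
  - replace (Im (l * g t + f t * m)%C) with
      ((Re l * Im (g t) + Re (f t) * Im m) + (Im l * Re (g t) + Im (f t) * Re m))
      by (simpl; unfold Re, Im; ring).
    apply (is_derive_plus (V := R_NormedModule) (fun s => Re (f s) * Im (g s))
             (fun s => Im (f s) * Re (g s))); now apply M.
Qed.

Lemma is_Cderive_comp_opp (f : R -> C) (t : R) (l : C) :
  is_Cderive f (- t) l -> is_Cderive (fun s => f (- s)) t (- l)%C.
Proof.
  assert (G : forall (g : R -> R) dg, is_derive g (- t) dg ->
                is_derive (fun s => g (- s)) t (- dg)).
  { intros g dg Hg. replace (- dg) with (scal (-1) dg)
      by (unfold scal; simpl; unfold mult; simpl; ring).
    apply (is_derive_comp (V := R_NormedModule) g Ropp); [exact Hg|].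
    auto_derive; [exact I|ring]. }
  intros [H1 H2]. split; [apply (G (fun s => Re (f s)))|apply (G (fun s => Im (f s)))]; assumption.
Qed.

Lemma is_derive_rising (a : R) (n : nat) : (forall j, a + INR j <> 0) ->
  is_derive (fun s => rising s n) a (rising a n * harm a n).
Proof.
  intros H. induction n as [|n IH].
  - simpl. rewrite Rmult_0_r. apply (is_derive_const (V := R_NormedModule)).
  - cbn [rising harm].
    replace (rising a n * (a + INR n) * (harm a n + / (a + INR n)))
      with (rising a n * harm a n * (a + INR n) + rising a n * 1) by (field; apply H).
    apply (is_derive_mult (K := R_AbsRing) (fun s => rising s n) (fun s => s + INR n)).
    + exact IH.
    + auto_derive; [exact I|ring].
    + intros; apply Rmult_comm.
Qed.

Lemma is_derive_bes (nu : R) (n : nat) : (forall j, nu + 1 + INR j <> 0) ->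
  is_derive (fun s => bes s n) nu (dbes nu n).
Proof.
  intros H. unfold dbes, bes.
  generalize (is_derive_rising (nu + 1) n H) (rising_neq_0 (nu + 1) n H) (INR_fact_neq_0 n).
  generalize (INR (fact n)) ((-1) ^ n). intros q c D H1 H2.
  apply (is_derive_ext (fun s => c / q * / rising (s + 1) n)).
  { intros s. unfold Rdiv. now rewrite Rinv_mult, Rmult_assoc. }
  replace (- (c / (q * rising (nu + 1) n)) * harm (nu + 1) n)
    with (c / q * (- (1 * (rising (nu + 1) n * harm (nu + 1) n)) / rising (nu + 1) n ^ 2))
    by (field; now split).
  apply is_derive_scal, is_derive_inv; [|exact H1].
  apply (is_derive_comp (V := R_NormedModule) (fun s => rising s n) (fun s => s + 1)).
  - exact D.
  - auto_derive; [exact I|ring].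
Qed.

Lemma is_Cderive_psum_bes (nu : R) (x : C) : nonint nu ->
  is_Cderive (fun mu => psum (bes mu) x) nu (psum (dbes nu) x).
Proof.
  intros H. destruct (nonint_dist_shift nu H) as [d Hd].
  assert (Hd1 : forall s, Rabs (s - nu) < d -> forall j, d <= Rabs (s + 1 + INR j)).
  { intros s Hs j. now apply Hd. }
  assert (H0 : 0 < d) by apply cond_pos.
  assert (D : forall n s, Rabs (s - nu) < d -> is_derive (fun s => bes s n) s (dbes s n)).
  { intros n s Hs.
    apply is_derive_bes. intros j E. generalize (Hd1 s Hs j). rewrite E, Rabs_R0. lra. }
  assert (G : forall c, (forall n, Rabs (c n) <= Cmod x ^ n) ->
     is_derive (fun s => Series (fun n => bes s n * c n)) nu (Series (fun n => dbes nu n * c n))).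
  { intros c Hc.
    apply (is_derive_Series (fun s n => bes s n * c n) (fun s n => dbes s n * c n) nu d
             (fun n => dbes_majorant d n * Cmod x ^ n)); [exact H0| | | |].
    - intros n s Hs.
      replace (dbes s n * c n) with (dbes s n * c n + bes s n * 0) by ring.
      apply (is_derive_mult (K := R_AbsRing) (fun s => bes s n) (fun _ => c n)).
      + now apply D.
      + apply (is_derive_const (V := R_NormedModule)).
      + intros; apply Rmult_comm.
    - intros n s Hs. rewrite Rabs_mult.
      apply Rmult_le_compat; try apply Rabs_pos; [|apply Hc].
      apply Rabs_dbes_le; [exact H0|now apply Hd1].
    - apply (ex_series_ext (fun n => Rabs (dbes_majorant d n) * Cmod x ^ n)).
      + intros n. rewrite Rabs_pos_eq; [reflexivity|].
        eapply Rle_trans; [apply Rabs_pos|]. apply (Rabs_dbes_le nu d n H0), Hd1.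
        rewrite Rminus_diag, Rabs_R0. exact H0.
      + apply entire_dbes_majorant; [exact H0|apply Cmod_ge_0].
    - apply ex_series_Rabs, (ex_series_psum_abs _ _ x Hc). now apply entire_bes. }
  split.
  - rewrite Re_psum.
    apply (is_derive_ext (fun s => Series (fun n => bes s n * Re (x ^ n)%C))).
    + intros s. now rewrite Re_psum.
    + apply G, Rabs_Re_pow.
  - rewrite Im_psum.
    apply (is_derive_ext (fun s => Series (fun n => bes s n * Im (x ^ n)%C))).
    + intros s. now rewrite Im_psum.
    + apply G, Rabs_Im_pow.
Qed.

(** * Principal powers and logarithms *)

Lemma Cpower_RtoC (w : C) (a : R) :
  Cpower w (RtoC a)
  = (exp (a * Re (Clog w)) * cos (a * Im (Clog w)),
     exp (a * Re (Clog w)) * sin (a * Im (Clog w))).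
Proof. unfold Cpower, Cexp. now rewrite Re_RtoC_mult, Im_RtoC_mult. Qed.

Lemma Cpower_plus (w : C) (a b : R) :
  Cpower w (RtoC (a + b)) = (Cpower w (RtoC a) * Cpower w (RtoC b))%C.
Proof.
  rewrite !Cpower_RtoC, !Rmult_plus_distr_r, exp_plus, cos_plus, sin_plus.
  unfold Cmult. simpl. f_equal; ring.
Qed.

Lemma Cpower_0 (w : C) : Cpower w (RtoC 0) = RtoC 1.
Proof.
  rewrite Cpower_RtoC, !Rmult_0_l, exp_0, cos_0, sin_0. unfold RtoC. f_equal; ring.
Qed.

Lemma is_Cderive_Cpower (w : C) (t : R) :
  is_Cderive (fun s => Cpower w (RtoC s)) t (Clog w * Cpower w (RtoC t))%C.
Proof.
  set (p := Re (Clog w)). set (q := Im (Clog w)). split.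
  - apply (is_derive_ext (fun s => exp (s * p) * cos (s * q))).
    { intros s. now rewrite Cpower_RtoC. }
    rewrite Re_Cmult, Cpower_RtoC. fold p q. simpl. auto_derive; [exact I|ring].
  - apply (is_derive_ext (fun s => exp (s * p) * sin (s * q))).
    { intros s. now rewrite Cpower_RtoC. }
    rewrite Im_Cmult, Cpower_RtoC. fold p q. simpl. auto_derive; [exact I|ring].
Qed.

Lemma Carg_scal (r : R) (u : C) : 0 < r -> Carg (RtoC r * u) = Carg u.
Proof.
  intros Hr. unfold Carg. rewrite Re_RtoC_mult, Im_RtoC_mult, Cmod_mult, Cmod_R.
  rewrite (Rabs_pos_eq r) by lra.
  replace (r * Re u / (r * Cmod u)) with (Re u / Cmod u)
    by (unfold Rdiv; rewrite Rinv_mult; generalize (/ Cmod u); intros; field; lra).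
  destruct (Rle_dec 0 (Im u)) as [H|H], (Rle_dec 0 (r * Im u)) as [H'|H'];
    try reflexivity; exfalso.
  - apply H'. now apply Rmult_le_pos; [lra|].
  - apply H. apply Rmult_le_reg_l with r; [exact Hr|]. lra.
Qed.

Lemma Carg_conj (z : C) : z <> RtoC 0 -> Rabs (Carg z) < PI -> Carg (Cconj z) = - Carg z.
Proof.
  intros Hz H. assert (Hm := Cmod_gt_0 z). apply Hm in Hz. clear Hm.
  unfold Carg in *. rewrite Cmod_conj.
  change (Re (Cconj z)) with (Re z). change (Im (Cconj z)) with (- Im z).
  destruct (Rle_dec 0 (Im z)) as [H1|H1], (Rle_dec 0 (- Im z)) as [H2|H2]; try lra.
  assert (E : Im z = 0) by lra.
  assert (Em : Cmod z = Rabs (Re z)).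
  { unfold Cmod, Im, Re in *. rewrite E. replace (fst z ^ 2 + 0 ^ 2) with (Rsqr (fst z))
      by (unfold Rsqr; ring). apply sqrt_Rsqr_abs. }
  rewrite Em in *. destruct (Rle_dec 0 (Re z)) as [H3|H3].
  - rewrite Rabs_pos_eq in * by exact H3. rewrite Rdiv_diag, acos_1 by lra. ring.
  (* On the negative real axis the argument is [PI], which the hypothesis excludes. *)
  - exfalso. rewrite (Rabs_left (Re z)) in * by lra.
    replace (Re z / - Re z) with (Ropp 1) in H by (field; lra).
    rewrite acos_opp, acos_1, Rminus_0_r, Rabs_pos_eq in H; generalize PI_RGT_0; lra.
Qed.

(** 2 / z is a positive multiple of the conjugate of z, and off the cut conjugation negates the
    argument. On the cut both arguments would be pi. *)
Lemma Clog_inv_half (z : C) : z <> RtoC 0 -> Rabs (Carg z) < PI ->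
  Clog (RtoC 2 / z) = (- Clog (z / RtoC 2))%C.
Proof.
  intros Hz H. assert (Hm := proj1 (Cmod_gt_0 z) Hz).
  assert (N2 : RtoC 2 <> RtoC 0) by (intros E; injection E; lra).
  unfold Clog, Copp. simpl. f_equal.
  - rewrite !Cmod_div, Cmod_R, Rabs_pos_eq by (assumption || lra).
    rewrite <- ln_Rinv by (apply Rdiv_lt_0_compat; lra). f_equal. field. lra.
  - replace (z / RtoC 2)%C with (RtoC (/ 2) * z)%C
      by (rewrite RtoC_inv by lra; unfold Cdiv; ring).
    replace (RtoC 2 / z)%C with (RtoC (2 / Cmod z ^ 2) * Cconj z)%C.
    + rewrite !Carg_scal by (first [lra | apply Rdiv_lt_0_compat; [lra|now apply pow_lt]]).
      now apply Carg_conj.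
    + rewrite RtoC_div, Cmod2_conj by (apply pow_nonzero; lra). field. split; [exact Hz|].
      intros E. apply Hz. rewrite <- (Cconj_conj z), E. unfold Cconj. simpl. now rewrite Ropp_0.
Qed.

(** * Hypergeometric series *)

Lemma CSeries_ext (a b : nat -> C) : (forall n, a n = b n) -> CSeries a = CSeries b.
Proof. intros H. now replace b with a by now apply functional_extensionality. Qed.

(** The argument - z^2 equals -4 x for x = (z/2)^2, which is where the powers of -4 in the closed
    forms come from. *)
Lemma pFq_psum (a b : list R) (z : C) (c : nat -> R) :
  (forall k, poch_list a k / poch_list b k * (-4) ^ k / INR (fact k) = c k) ->
  pFq a b (- z ^ 2)%C = psum c ((z / RtoC 2) ^ 2)%C.
Proof.
  intros H. apply CSeries_ext. intros k. rewrite <- (H k).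
  replace (- z ^ 2)%C with (RtoC (-4) * (z / RtoC 2) ^ 2)%C.
  - rewrite Cpow_mult_l, <- RtoC_pow.
    generalize (poch_list a k / poch_list b k). intros q.
    rewrite RtoC_div, !RtoC_mult by apply INR_fact_neq_0. unfold Cdiv. ring.
  - replace (-4) with (- (2 * 2)) by ring. rewrite RtoC_opp, RtoC_mult. field.
Qed.

Lemma pFq_besA (nu : R) (z : C) : nonint nu -> (forall j : nat, 2 * nu + INR j <> 0) ->
  pFq [nu; nu + 1 / 2] [nu + 1; nu + 1; 2 * nu + 1] (- z ^ 2)%C
  = psum (besA nu) ((z / RtoC 2) ^ 2)%C.
Proof.
  intros H H2. apply pFq_psum. intros k.
  assert (H3 : forall j, 2 * nu + 1 + INR j <> 0).
  { intros j. generalize (H2 (S j)). rewrite S_INR. lra. }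
  rewrite <- (besA_closed nu k H H3). unfold poch_list, fold_right.
  rewrite !poch_rising; [reflexivity| | | |].
  - exact H3.
  - intros j. now apply nonint_shift_nat1.
  (* Twice nu + 1/2 + j is 2 nu + (2 j + 1). *)
  - intros j. generalize (H2 (2 * j + 1)%nat). rewrite plus_INR, mult_INR. simpl. lra.
  - intros j. rewrite INR_IZR_INZ. now apply nonint_shift.
Qed.

Lemma pFq_besG (nu : R) (z : C) : nonint nu ->
  (z ^ 2 / RtoC (4 * (1 - nu ^ 2))
     * pFq [1; 1; 3 / 2]%R [2; 2; 2 - nu; 2 + nu]%R (- z ^ 2))%C
  = psum (besG nu) ((z / RtoC 2) ^ 2)%C.
Proof.
  intros H.
  assert (P0 : 1 - nu ^ 2 <> 0).
  { replace (1 - nu ^ 2) with ((nu + IZR 1) * (- nu + IZR 1)) by ring.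
    apply Rmult_integral_contrapositive_currified; apply nonint_shift;
      [exact H|now apply nonint_opp]. }
  rewrite (pFq_psum _ _ z (pconst (1 - nu ^ 2) * pshift (besG nu))%ps).
  - rewrite psum_scal, (psum_shift (besG nu)) by now apply entire_besG.
    change (besG nu 0) with 0.
    replace (RtoC (4 * (1 - nu ^ 2))) with (RtoC 2 * RtoC 2 * RtoC (1 - nu ^ 2))%C
      by (rewrite <- !RtoC_mult; f_equal; ring).
    field. intros E. injection E. lra.
  - intros k. rewrite pmul_const. unfold pshift. rewrite <- besG_closed by exact H.
    unfold poch_list, fold_right.
    assert (Pp : forall a, 0 < a -> poch a k = rising a k).
    { intros a Ha. apply poch_rising. intros j. generalize (pos_INR j). lra. }
    assert (Hm : forall j, 2 - nu + INR j <> 0).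
    { intros j. replace (2 - nu) with (- nu + 2) by ring.
      apply (nonint_shift_nat (- nu) 2 j), nonint_opp, H. }
    assert (Hp : forall j, 2 + nu + INR j <> 0).
    { intros j. rewrite (Rplus_comm 2). apply (nonint_shift_nat nu 2 j H). }
    rewrite !Pp, !poch_rising by (assumption || lra).
    generalize (rising_neq_0 _ k Hm) (rising_neq_0 _ k Hp). intros Q1 Q2.
    assert (Q3 : rising 2 k <> 0).
    { apply rising_neq_0. intros j. generalize (pos_INR j). lra. }
    generalize (INR_fact_neq_0 k). intros Q4.
    field. repeat split; assumption.
Qed.

Lemma filterlim_pmul {T : Type} (F : (T -> Prop) -> Prop) {FF : Filter F}
  (a b : T -> nat -> R) (la lb : nat -> R) (n : nat) :
  (forall k, filterlim (fun s => a s k) F (locally (la k))) ->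
  (forall k, filterlim (fun s => b s k) F (locally (lb k))) ->
  filterlim (fun s => pmul (a s) (b s) n) F (locally (pmul la lb n)).
Proof.
  intros Ha Hb.
  apply (filterlim_ext (fun s => sum_f_R0 (fun k => a s k * b s (n - k)%nat) n)).
  { intros s. symmetry. apply pmul_sum. }
  rewrite (pmul_sum la lb n : pmul la lb n = _).
  apply (filterlim_sum_f_R0 F (fun s k => a s k * b s (n - k)%nat)
           (fun k => la k * lb (n - k)%nat)). intros k _.
  eapply filterlim_comp_2; [apply Ha|apply Hb|].
  apply (filterlim_mult (K := R_AbsRing)).
Qed.

Lemma filterlim_besA_opp (nu : R) (n : nat) : nonint nu ->
  filterlim (fun s => besA (- s) n) (Rbar_locally' nu) (locally (besA (- nu) n)).
Proof.
  intros H.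
  assert (C : continuous (fun s => besA s n) (- nu)).
  { unfold besA, Rdiv.
    apply (continuous_mult (K := R_AbsRing) (fun s => s * (bes s * bes s)%ps n) (fun s => / (s + INR n))).
    - apply (continuous_mult (K := R_AbsRing) (fun s => s) (fun s => (bes s * bes s)%ps n)).
      + apply continuous_id.
      + assert (B : forall k, filterlim (fun s => bes s k) (locally (- nu)) (locally (bes (- nu) k))).
        { intros k. apply (ex_derive_continuous (V := R_NormedModule)). eexists.
          apply is_derive_bes. intros j. now apply nonint_shift_nat1, nonint_opp. }
        apply (filterlim_pmul (locally (- nu)) bes bes (bes (- nu)) (bes (- nu)) n); exact B.
    - apply (ex_derive_continuous (V := R_NormedModule)). auto_derive.
      rewrite INR_IZR_INZ. now apply nonint_shift, nonint_opp. }
  apply (filterlim_filter_le_1 (F := locally nu)).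
  - intros P [e He]. exists e. intros y Hy _. now apply He.
  - apply (filterlim_comp _ _ _ Ropp (fun s => besA s n) _ (locally (- nu))); [|exact C].
    apply (filterlim_opp (V := R_NormedModule)).
Qed.

(** Near a half-integer, but away from it, the 2F3 is the sum of [besA (- s)], whose coefficients
    are continuous through the half-integer; uniform majorants pass this to the sum. *)
Lemma pFq_cont_besA (nu : R) (z : C) : nonint nu -> 0 < nu ->
  pFq_cont (fun mu : R => [- mu; 1 / 2 - mu]) (fun mu : R => [1 - mu; 1 - mu; 1 - 2 * mu])
    (- z ^ 2)%C nu
  = psum (besA (- nu)) ((z / RtoC 2) ^ 2)%C.
Proof.
  intros H Hpos.
  assert (G : forall s, nonint s -> (forall j : nat, 2 * s <> INR j) ->
    pFq [- s; 1 / 2 - s] [1 - s; 1 - s; 1 - 2 * s] (- z ^ 2)%C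
    = psum (besA (- s)) ((z / RtoC 2) ^ 2)%C).
  { intros s Hs H2.
    replace (1 / 2 - s) with (- s + 1 / 2) by ring. replace (1 - s) with (- s + 1) by ring.
    replace (1 - 2 * s) with (2 * - s + 1) by ring. apply pFq_besA.
    - now apply nonint_opp.
    - intros j E. apply (H2 j). lra. }
  unfold pFq_cont. destruct (excluded_middle_informative _) as [HE|HE].
  - set (x := ((z / RtoC 2) ^ 2)%C).
    (* For non-integer [nu], only the lower parameter 1 - 2 nu can be a nonpositive integer. *)
    assert (H2 : exists m : Z, 2 * nu = IZR m).
    { assert (N1 : forall n, 1 - nu <> - INR n).
      { intros n E. apply (H (Z.of_nat (S n))). rewrite <- INR_IZR_INZ, S_INR. lra. }
      inversion HE as [? ? [n E]|? ? HE1]; subst; [now apply N1 in E|].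
      inversion HE1 as [? ? [n E]|? ? HE2]; subst; [now apply N1 in E|].
      inversion HE2 as [? ? [n E]|? ? HE3]; subst; [|inversion HE3].
      exists (Z.of_nat (S n)). rewrite <- INR_IZR_INZ, S_INR. lra. }
    destruct H2 as [m Hm].
    destruct (nonint_dist_shift _ (nonint_opp nu H)) as [d Hd].
    assert (L : forall c, (forall n, Rabs (c n) <= Cmod x ^ n) ->
      filterlim (fun s => Series (fun n => besA (- s) n * c n)) (Rbar_locally' nu)
        (locally (Series (fun n => besA (- nu) n * c n)))).
    { intros c Hc.
      (* Bounds the factor [Rabs s * / d] of [Rabs_besA_le] over the whole ball of radius [d]. *)
      set (K := (Rabs nu + d) * / d).
      assert (Bd : forall s, Rabs (s - nu) < d -> forall n,
        Rabs (besA (- s) n * c n)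
        <= Rabs (K * (bes_majorant d * bes_majorant d)%ps n) * Cmod x ^ n).
      { intros s Hs n. rewrite Rabs_mult.
        apply Rmult_le_compat; try apply Rabs_pos; [|apply Hc].
        eapply Rle_trans; [|apply Rle_abs].
        assert (Hs' : Rabs (- s - - nu) < d).
        { replace (- s - - nu) with (- (s - nu)) by ring. now rewrite Rabs_Ropp. }
        eapply Rle_trans; [apply (Rabs_besA_le (- s) d n (cond_pos d) (Hd (- s) Hs'))|].
        apply Rmult_le_compat_r.
        - eapply Rle_trans; [apply Rabs_pos|].
          apply (Rabs_pmul_le (bes (- s)) (bes (- s)));
            intros k; apply Rabs_bes_le; try apply cond_pos; now apply Hd.
        - apply Rmult_le_compat_r; [apply Rlt_le, Rinv_0_lt_compat, cond_pos|].
          rewrite Rabs_Ropp. replace s with (nu + (s - nu)) by ring.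
          eapply Rle_trans; [apply Rabs_triang|]. lra. }
      apply (filterlim_Series_dominated _ _ _
        (fun n => Rabs (K * (bes_majorant d * bes_majorant d)%ps n) * Cmod x ^ n)).
      - intros n.
        eapply filterlim_comp_2; [now apply filterlim_besA_opp|apply filterlim_const|].
        apply (filterlim_mult (K := R_AbsRing)).
      - exists d. intros s Hs _. now apply Bd.
      - apply Bd. rewrite Rminus_diag, Rabs_R0. apply cond_pos.
      - apply entire_besA_majorant; [apply cond_pos|apply Cmod_ge_0]. }
    (* Within 1/4 of [nu], the number 2 s is less than 1/2 away from the integer m = 2 nu; it can be
       an integer only if it is m, that is, at the excluded point s = nu. *)
    assert (N : Rbar_locally' nu (fun s => psum (besA (- s)) x
        = pFq [- s; 1 / 2 - s] [1 - s; 1 - s; 1 - 2 * s] (- z ^ 2)%C)).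
    { destruct (locally_nonint nu H) as [e He].
      assert (Hq : 0 < Rmin e (1 / 4)) by (apply Rmin_pos; [apply cond_pos|lra]).
      exists (mkposreal _ Hq). intros s Hs Hne. symmetry. apply G.
      - apply He. eapply Rlt_le_trans; [exact Hs|]. apply Rmin_l.
      - intros j E.
        assert (Hs4 : Rabs (s - nu) < 1 / 4)
          by (eapply Rlt_le_trans; [exact Hs|]; apply Rmin_r).
        apply Rabs_def2 in Hs4. rewrite INR_IZR_INZ in E.
        assert (Z.of_nat j = m).
        { assert (A1 : IZR (Z.of_nat j) < IZR (m + 1)) by (rewrite plus_IZR; lra).
          assert (A2 : IZR m < IZR (Z.of_nat j + 1)) by (rewrite plus_IZR; lra).
          apply lt_IZR in A1, A2. lia. }
        subst m. apply Hne. lra. }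
    transitivity (Re (psum (besA (- nu)) x), Im (psum (besA (- nu)) x));
      [unfold RClim; f_equal|now destruct (psum (besA (- nu)) x)].
    + rewrite Re_psum.
      rewrite (is_lim_unique _ _ (Finite (Series (fun k => besA (- nu) k * Re (x ^ k)%C)))); [reflexivity|].
      apply (filterlim_ext_loc (fun s => Series (fun k => besA (- s) k * Re (x ^ k)%C))).
      * revert N. apply filter_imp. intros s <-. now rewrite Re_psum.
      * apply L, Rabs_Re_pow.
    + rewrite Im_psum.
      rewrite (is_lim_unique _ _ (Finite (Series (fun k => besA (- nu) k * Im (x ^ k)%C)))); [reflexivity|].
      apply (filterlim_ext_loc (fun s => Series (fun k => besA (- s) k * Im (x ^ k)%C))).
      * revert N. apply filter_imp. intros s <-. now rewrite Im_psum.
      * apply L, Rabs_Im_pow.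
  (* If 2 nu were a natural number, it would be 0, against [0 < nu], or it would make 1 - 2 nu a
     nonpositive integer, the case already treated. *)
  - apply G; [exact H|]. intros [|j] E.
    + simpl in E. lra.
    + apply HE. right. right. left. exists j. rewrite S_INR in E. lra.
Qed.

(** * Derivatives of Bessel functions with respect to the order *)

Lemma CSeries_scal (c : R) (f : nat -> C) :
  CSeries (fun k => RtoC c * f k)%C = (RtoC c * CSeries f)%C.
Proof.
  apply C_ext.
  - rewrite Re_RtoC_mult. unfold CSeries. simpl. rewrite <- Series_scal_l.
    apply Series_ext. intros n. apply Re_RtoC_mult.
  - rewrite Im_RtoC_mult. unfold CSeries. simpl. rewrite <- Series_scal_l.
    apply Series_ext. intros n. apply Im_RtoC_mult.
Qed.

Lemma RtoC_neq_0 (x : R) : x <> 0 -> RtoC x <> RtoC 0.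
Proof. intros H E. now injection E. Qed.

Lemma BesselJ_psum (nu : R) (z : C) : nonint nu ->
  BesselJ nu z = (Cpower (z / RtoC 2) (RtoC nu)
    * (RtoC (/ Gamma (nu + 1)) * psum (bes nu) ((z / RtoC 2) ^ 2)))%C.
Proof.
  intros H. unfold BesselJ, psum. f_equal. rewrite <- CSeries_scal.
  apply CSeries_ext. intros k.
  assert (H1 : forall j, nu + 1 + INR j <> 0) by (intros j; now apply nonint_shift_nat1).
  replace (nu + INR k + 1) with (nu + 1 + INR k) by ring.
  rewrite Gamma_add by exact H1.
  rewrite Cpow_mult_r. unfold bes.
  generalize (rising_neq_0 _ k H1) (Gamma_neq_0 _ H1) (INR_fact_neq_0 k).
  intros R1 R2 R3.
  replace (RtoC (-1) ^ k)%C with (RtoC ((-1) ^ k)) by apply RtoC_pow.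
  rewrite RtoC_div, RtoC_inv, !RtoC_mult by
    (try apply Rmult_integral_contrapositive_currified; assumption).
  field. repeat split; now apply RtoC_neq_0.
Qed.

Lemma digamma_succ (x : R) : (forall j, x + INR j <> 0) -> digamma (x + 1) = digamma x + 1 / x.
Proof.
  intros H.
  assert (H1 : forall j, x + 1 + INR j <> 0).
  { intros j. rewrite Rplus_assoc, (Rplus_comm 1), <- S_INR. apply H. }
  assert (Hx : x <> 0) by (generalize (H O); simpl; now rewrite Rplus_0_r).
  generalize (ex_derive_Gamma x H) (ex_derive_Gamma _ H1) (Gamma_neq_0 x H). intros D1 D2 G1.
  assert (E : Derive (fun y => Gamma (y + 1)) x = Derive (fun y => y * Gamma y) x).
  { apply Derive_ext_loc. exists (mkposreal (Rabs x) (Rabs_pos_lt x Hx)). intros y Hy.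
    apply Gamma_succ. intros ->. change (Rabs (0 - x) < Rabs x) in Hy.
    rewrite Rminus_0_l, Rabs_Ropp in Hy. lra. }
  assert (E1 : Derive (fun y => Gamma (y + 1)) x = Derive Gamma (x + 1)).
  { apply is_derive_unique. auto_derive; [repeat split; assumption|].
    change (fun y : R => Gamma y) with Gamma. ring. }
  assert (E2 : Derive (fun y => y * Gamma y) x = Gamma x + x * Derive Gamma x).
  { apply is_derive_unique. auto_derive; [repeat split; assumption|].
    change (fun y : R => Gamma y) with Gamma. ring. }
  unfold digamma. rewrite <- E1, E, E2, Gamma_succ by exact Hx. field. now split.
Qed.

Lemma is_Cderive_BesselJ (nu : R) (z : C) : nonint nu ->
  is_Cderive (fun mu => BesselJ mu z) nu
    (BesselJ nu z * (Clog (z / RtoC 2) - RtoC (digamma nu + 1 / nu))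
     + Cpower (z / RtoC 2) (RtoC nu)
       * (RtoC (/ Gamma (nu + 1)) * psum (dbes nu) ((z / RtoC 2) ^ 2)))%C.
Proof.
  intros H.
  assert (H0 : forall j, nu + INR j <> 0).
  { intros j. rewrite INR_IZR_INZ. now apply nonint_shift. }
  assert (H1 : forall j, nu + 1 + INR j <> 0) by (intros j; now apply nonint_shift_nat1).
  assert (D : is_derive (fun s => / Gamma (s + 1)) nu
                (- (digamma nu + 1 / nu) * / Gamma (nu + 1))).
  { rewrite <- digamma_succ by exact H0. unfold digamma.
    generalize (Gamma_neq_0 _ H1) (ex_derive_Gamma _ H1). intros G1 G2.
    auto_derive; [now repeat split|].
    change (fun y : R => Gamma y) with Gamma. field. exact G1. }
  apply (is_Cderive_ext_loc (fun mu => Cpower (z / RtoC 2) (RtoC mu)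
    * (RtoC (/ Gamma (mu + 1)) * psum (bes mu) ((z / RtoC 2) ^ 2)))%C).
  { generalize (locally_nonint nu H). apply filter_imp. intros s Hs. symmetry.
    now apply BesselJ_psum. }
  generalize (is_Cderive_mult _ _ _ _ _ (is_Cderive_Cpower (z / RtoC 2) nu)
    (is_Cderive_mult _ _ _ _ _ (is_Cderive_RtoC _ _ _ D)
      (is_Cderive_psum_bes nu ((z / RtoC 2) ^ 2)%C H))).
  rewrite BesselJ_psum by exact H.
  rewrite RtoC_mult, RtoC_opp.
  match goal with |- is_Cderive _ _ ?a -> is_Cderive _ _ ?b => replace b with a by ring end.
  trivial.
Qed.

(** The term 1 / (2 nu) of [psum_dbes] halves the 1 / nu coming from digamma (nu + 1), and f_{-nu}
    is absorbed into J_{-nu}(z) by writing (z/2)^nu = (z/2)^(2 nu) (z/2)^(-nu). *)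
Lemma is_Cderive_BesselJ_closed (nu : R) (z : C) : nonint nu ->
  is_Cderive (fun mu => BesselJ mu z) nu
    (BesselJ nu z * (Clog (z / RtoC 2) - RtoC (digamma nu) - RtoC (1 / (2 * nu))
                     - psum (besG nu) ((z / RtoC 2) ^ 2))
     - RtoC (sin (PI * nu) / (2 * PI) * Gamma (- nu) ^ 2) * BesselJ (- nu) z
       * Cpower (z / RtoC 2) (RtoC (2 * nu)) * psum (besA nu) ((z / RtoC 2) ^ 2))%C.
Proof.
  intros H.
  generalize (is_Cderive_BesselJ nu z H).
  match goal with |- is_Cderive _ _ ?a -> is_Cderive _ _ ?b => replace b with a; [trivial|] end.
  rewrite psum_dbes, (BesselJ_psum nu), (BesselJ_psum (- nu)) by (try apply nonint_opp; exact H).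
  replace (RtoC (2 * nu)) with (RtoC (nu + nu)) by (f_equal; ring).
  rewrite Cpower_plus.
  assert (Hn : nu <> 0) by (intros E; now apply (H 0%Z)).
  assert (EE : (Cpower (z / RtoC 2) (RtoC (- nu)) * Cpower (z / RtoC 2) (RtoC nu) = RtoC 1)%C).
  { rewrite <- Cpower_plus, Rplus_opp_l. apply Cpower_0. }
  set (E := Cpower (z / RtoC 2) (RtoC nu)) in *.
  set (E' := Cpower (z / RtoC 2) (RtoC (- nu))) in *.
  set (x := ((z / RtoC 2) ^ 2)%C).
  (* The reflection formula exchanges the prefactor 1 / Gamma (nu + 1) of J_nu for the 1 / Gamma (1
     - nu) that belongs to J_{-nu}. *)
  assert (K : 1 / (2 * nu) * / Gamma (nu + 1)
              = sin (PI * nu) / (2 * PI) * Gamma (- nu) ^ 2 * / Gamma (- nu + 1)).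
  { assert (G1 : Gamma nu <> 0).
    { apply Gamma_neq_0. intros j. rewrite INR_IZR_INZ. now apply nonint_shift. }
    assert (G2 : Gamma (- nu) <> 0).
    { apply Gamma_neq_0. intros j. rewrite INR_IZR_INZ. now apply nonint_shift, nonint_opp. }
    generalize (sin_PI_neq_0 nu H) PI_neq0 (Gamma_reflection nu H). intros Hs HPI HR.
    rewrite !Gamma_succ by lra.
    replace (Gamma (- nu)) with (- PI / (nu * sin (PI * nu)) / Gamma nu)
      by (rewrite <- HR; field; exact G1).
    field. repeat split; assumption. }
  transitivity (E * (RtoC (/ Gamma (nu + 1)) * psum (bes nu) x)
       * (Clog (z / RtoC 2) - RtoC (digamma nu) - RtoC (1 / (2 * nu)) - psum (besG nu) x)
       - E * RtoC (1 / (2 * nu) * / Gamma (nu + 1)) * psum (bes (- nu)) x * psum (besA nu) x)%C.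
  - replace (digamma nu + 1 / nu) with (digamma nu + (1 / (2 * nu) + 1 / (2 * nu)))
      by (field; exact Hn).
    rewrite !RtoC_plus, (RtoC_mult _ (/ Gamma (nu + 1))). ring.
  - rewrite K, (RtoC_mult _ (/ Gamma (- nu + 1))). ring [EE].
Qed.

Theorem mainTheorem2 (nu : R) (z : C)
  (hnu : 0 < nu) (hnuZ : forall m : Z, nu <> IZR m)
  (hz : z <> RtoC 0) (hargz : Rabs (Carg z) < PI) :
  @is_derive R_AbsRing C_R_NormedModule (fun mu : R => BesselY mu z) nu
    (BesselJ nu z *
       (RtoC (Gamma nu ^ 2 / (2 * PI)) * Cpower (z / 2) (RtoC (- 2 * nu)) *
          pFq_cont (fun mu : R => [- mu; 1 / 2 - mu]%R)
                   (fun mu : R => [1 - mu; 1 - mu; 1 - 2 * mu]%R)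
                   (- z ^ 2) nu
        - RtoC (PI * (/ sin (PI * nu)) ^ 2))
     - RtoC (cos (PI * nu) / (2 * PI) * Gamma (- nu) ^ 2) *
         BesselJ (- nu) z * Cpower (z / 2) (RtoC (2 * nu)) *
         pFq [nu; nu + 1 / 2]%R [nu + 1; nu + 1; 2 * nu + 1]%R (- z ^ 2)
     + (Clog (2 / z) + RtoC (1 / (2 * nu)) + RtoC (digamma nu)
        + z ^ 2 / RtoC (4 * (1 - nu ^ 2)) *
            pFq [1; 1; 3 / 2]%R [2; 2; 2 - nu; 2 + nu]%R (- z ^ 2)) *
         (BesselY nu z
          - 2 * RtoC (cos (PI * nu) / sin (PI * nu)) * BesselJ nu z))%C.
Proof.
  assert (H : nonint nu) by exact hnuZ.
  assert (Hs := sin_PI_neq_0 nu H).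
  rewrite pFq_cont_besA, pFq_besG, Clog_inv_half by assumption.
  rewrite pFq_besA by (try exact H; intros j; generalize (pos_INR j); lra).
  apply is_Cderive_is_derive.
  (* Splitting Y into cotangent and cosecant multiples leaves only products to differentiate. *)
  assert (EY : forall s, nonint s -> BesselY s z
    = (BesselJ s z * RtoC (cos (PI * s) / sin (PI * s)) - BesselJ (- s) z * RtoC (/ sin (PI * s)))%C).
  { intros s Hs'. generalize (sin_PI_neq_0 s Hs'). intros Hn. unfold BesselY.
    rewrite RtoC_div, RtoC_inv by exact Hn. field. now apply RtoC_neq_0. }
  apply (is_Cderive_ext_loc (fun s => BesselJ s z * RtoC (cos (PI * s) / sin (PI * s))
                                   - BesselJ (- s) z * RtoC (/ sin (PI * s)))%C).
  { generalize (locally_nonint nu H). apply filter_imp. intros s Hs'. symmetry. now apply EY. }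
  assert (D1 : is_derive (fun s => cos (PI * s) / sin (PI * s)) nu (- (PI * (/ sin (PI * nu)) ^ 2))).
  { auto_derive; [exact Hs|]. generalize (sin2_cos2 (PI * nu)). unfold Rsqr. intros E.
    replace (PI * (/ sin (PI * nu)) ^ 2)
      with (PI * (sin (PI * nu) * sin (PI * nu) + cos (PI * nu) * cos (PI * nu))
            / sin (PI * nu) ^ 2) by (rewrite E; field; exact Hs).
    field. exact Hs. }
  assert (D2 : is_derive (fun s => / sin (PI * s)) nu
                 (- (PI * (cos (PI * nu) / sin (PI * nu)) * / sin (PI * nu)))).
  { auto_derive; [exact Hs|]. field. exact Hs. }
  generalize (is_Cderive_minus _ _ _ _ _
    (is_Cderive_mult _ _ _ _ _ (is_Cderive_BesselJ_closed nu z H) (is_Cderive_RtoC _ _ _ D1))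
    (is_Cderive_mult _ _ _ _ _
       (is_Cderive_comp_opp _ _ _ (is_Cderive_BesselJ_closed (- nu) z (nonint_opp nu H)))
       (is_Cderive_RtoC _ _ _ D2))).
  match goal with |- is_Cderive _ _ ?a -> is_Cderive _ _ ?b => replace b with a; [trivial|] end.
  rewrite EY by exact H.
  (* In psi (- nu) = psi (nu) + 1 / nu + pi cot (pi nu), the term 1 / nu gives the orders nu and -
     nu the same bracket, G being even in the order, and pi cot (pi nu) cancels the derivative of
     the cosecant. *)
  rewrite besG_opp, digamma_opp, !Ropp_involutive by exact H.
  replace (2 * - nu) with (- 2 * nu) by ring.
  replace (PI * - nu) with (- (PI * nu)) by ring. rewrite sin_neg.
  assert (Hn : nu <> 0) by lra.
  generalize PI_neq0. intros HPI.
  replace (1 / (- 2 * nu)) with (- (1 / (2 * nu))) by (field; exact Hn).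
  replace (1 / nu) with (2 * (1 / (2 * nu))) by (field; exact Hn).
  replace (- sin (PI * nu) / (2 * PI) * Gamma nu ^ 2)
    with (- (sin (PI * nu) * (Gamma nu ^ 2 / (2 * PI)))) by (field; exact HPI).
  replace (sin (PI * nu) / (2 * PI) * Gamma (- nu) ^ 2)
    with (sin (PI * nu) * (Gamma (- nu) ^ 2 / (2 * PI))) by (field; exact HPI).
  replace (cos (PI * nu) / (2 * PI) * Gamma (- nu) ^ 2)
    with (cos (PI * nu) * (Gamma (- nu) ^ 2 / (2 * PI))) by (field; exact HPI).
  (* With these quantities abstracted, [sin (PI * nu)] is the only denominator left. *)
  generalize (1 / (2 * nu)) (Gamma nu ^ 2 / (2 * PI)) (Gamma (- nu) ^ 2 / (2 * PI))
    (PI * (/ sin (PI * nu)) ^ 2) (digamma nu). intros c ga gb p2 psi.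
  assert (Hs' := RtoC_neq_0 _ Hs).
  repeat first [rewrite RtoC_plus | rewrite RtoC_opp | rewrite RtoC_inv by exact Hs
               | rewrite RtoC_div by exact Hs | rewrite RtoC_mult].
  field. exact Hs'.
Qed.
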